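(* Let $\mathbb K$ be a field, let $f:\mathbb N^k\to\mathbb N^\ell$ be a surjective monoid homomorphism, let $H=\ker\bar f$, and let $\Gamma$ be a row-finite $\ell$-graph with no sources and with $\Gamma^0$ finite and nonempty. For $h\in H$ write $h=h_+-h_-$ (coordinatewise positive and negative parts), and put $$U_h=\sum_{v\in\Gamma^0}\ \sum_{\lambda\in v\Gamma^{f(h_+)}}s_{(\lambda,h_+)}s_{(\lambda,h_-)^*}\in\mathrm{KP}_{\mathbb K}(f^*\Gamma).$$ The assignment $$\iota:\mathbb K[H]\longrightarrow\mathrm{KP}_{\mathbb K}(f^*\Gamma),\qquad u_h\longmapsto U_h,$$ is an injective unital homomorphism with central image. In particular, $U_hU_g=U_{h+g}$ and $U_h^{-1}=U_{-h}$ for all $g,h\in H$. If $\Gamma$ is cofinal and aperiodic, then $$Z\bigl(\mathrm{KP}_{\mathbb K}(f^*\Gamma)\bigr)=\iota(\mathbb K[H]).$$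
   Context: $\mathbb N$ contains $0$. A $k$-graph is a countable small category $\Lambda$ with a functor $d:\Lambda\to\mathbb N^k$ satisfying the factorisation property: if $d(\lambda)=m+n$ there are unique composable $\mu,\nu$ with $\lambda=\mu\nu$, $d(\mu)=m$, $d(\nu)=n$. Objects are identified with $\Lambda^0=d^{-1}(0)$ (vertices); $r,s$ are range and source, and $\mu\nu$ is defined when $s(\mu)=r(\nu)$. Put $v\Lambda^n=\{\lambda: d(\lambda)=n,\ r(\lambda)=v\}$ and $v\Lambda w=\{\lambda:r(\lambda)=v,\ s(\lambda)=w\}$. $\Lambda$ is row-finite if every $v\Lambda^n$ is finite, and has no sources if every $v\Lambda^n$ is nonempty. For a commutative unital ring $R$ and a row-finite $k$-graph $\Lambda$ with no sources, $\mathrm{KP}_R(\Lambda)$ is the universal $R$-algebra generated by $\{p_v:v\in\Lambda^0\}\cup\{s_\lambda,s_{\lambda^*}:\lambda\in\Lambda\setminus\Lambda^0\}$, with $s_v=s_{v^*}=p_v$, subject to: (KP1) the $p_v$ are mutually orthogonal idempotents; (KP2) $s_\lambda s_\mu=s_{\lambda\mu}$ and $s_{\mu^*}s_{\lambda^*}=s_{(\lambda\mu)^*}$ whenever $\lambda\mu$ is defined, and $p_{r(\lambda)}s_\lambda=s_\lambda=s_\lambda p_{s(\lambda)}$, $p_{s(\lambda)}s_{\lambda^*}=s_{\lambda^*}=s_{\lambda^*}p_{r(\lambda)}$; (KP3) if $d(\lambda)=d(\mu)$ then $s_{\lambda^*}s_\mu=\delta_{\lambda,\mu}p_{s(\lambda)}$;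 (KP4) $p_v=\sum_{\lambda\in v\Lambda^n}s_\lambda s_{\lambda^*}$ for $v\in\Lambda^0$, $0\ne n\in\mathbb N^k$. It is unital, with $1=\sum_v p_v$, when $\Lambda^0$ is finite. Infinite paths: $\Gamma^\infty$ is the set of degree-preserving functors $x:\{(p,q):p\le q\in\mathbb N^\ell\}\to\Gamma$ (with $d(x(p,q))=q-p$); $x(n)=x(n,n)$, $v\Gamma^\infty=\{x:x(0)=v\}$, $(\sigma^mx)(p,q)=x(p+m,q+m)$. $\Gamma$ is cofinal if for every $v\in\Gamma^0$ and $x\in\Gamma^\infty$ there is $n\in\mathbb N^\ell$ with $v\Gamma x(n)\ne\varnothing$. $\Gamma$ is aperiodic if for every $v\in\Gamma^0$ there is $x\in v\Gamma^\infty$ with $\sigma^mx\ne\sigma^nx$ whenever $m\ne n$. Pullback: $f^*\Gamma=\{(\lambda,n)\in\Gamma\times\mathbb N^k:d(\lambda)=f(n)\}$, a $k$-graph with degree $d(\lambda,n)=n$ and product $(\lambda,n)(\mu,m)=(\lambda\mu,n+m)$; vertices $(v,0)$ are identified with $v\in\Gamma^0$. $\bar f:\mathbb Z^k\to\mathbb Z^\ell$ is the group completion of $f$; for $h\in H$ one has $f(h_+)=f(h_-)$. $\mathbb K[H]$ is the group algebra with basis $u_h$ ($h\in H$), $u_hu_g=u_{h+g}$. $Z(\cdot)$ denotes the center. *)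

(* Defs.v *)
From HB Require Import structures.
From mathcomp Require Import all_boot all_order all_algebra.
From mathcomp Require Import generic_quotient finmap monalg.
From mathcomp Require Import boolp classical_sets functions cardinality fsbigop.

Set Implicit Arguments.
Unset Strict Implicit.
Unset Printing Implicit Defensive.

Import Order.TTheory GRing.Theory Num.Theory.

Local Open Scope quotient_scope.
Local Open Scope classical_set_scope.
Local Open Scope ring_scope.

(* A countable small category with a degree functor, presented by its vertices
   and morphisms. [kcomp] is total, but only its values on composable pairs
   (src a = rg b) are constrained or ever used. [idp v] is the vertex v seen
   as an element of the degree-0 morphisms; by [kfact] every morphism of
   degree 0 has this form (see [deg0_idp]). *)
Record kgraph (k : nat) := KGraph {
  vtx : countType;
  mor : countType;
  rg : mor -> vtx;
  src : mor -> vtx;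
  idp : vtx -> mor;
  kcomp : mor -> mor -> mor;
  deg : mor -> 'rV[nat]_k;
  rg_idp : forall v, rg (idp v) = v;
  src_idp : forall v, src (idp v) = v;
  rg_comp : forall a b, src a = rg b -> rg (kcomp a b) = rg a;
  src_comp : forall a b, src a = rg b -> src (kcomp a b) = src b;
  comp_idl : forall a, kcomp (idp (rg a)) a = a;
  comp_idr : forall a, kcomp a (idp (src a)) = a;
  kcompA : forall a b c, src a = rg b -> src b = rg c ->
    kcomp a (kcomp b c) = kcomp (kcomp a b) c;
  deg_idp : forall v, deg (idp v) = 0;
  deg_comp : forall a b, src a = rg b -> deg (kcomp a b) = deg a + deg b;
  kfact : forall a (m n : 'rV[nat]_k), deg a = m + n ->
    exists! bc : mor * mor,
      [/\ src bc.1 = rg bc.2, a = kcomp bc.1 bc.2, deg bc.1 = m & deg bc.2 = n]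
}.

Arguments idp {k} _ _.
Arguments kcomp {k} _ _ _.

Lemma deg0_idp k (L : kgraph k) (a : mor L) : deg a = 0 -> a = idp L (rg a).
Proof.
move=> a0; have [p [_ puniq]] := @kfact k L a 0 0 (etrans a0 (esym (addr0 0))).
have h1 : p = (idp L (rg a), a).
  by apply: puniq => /=; rewrite src_idp comp_idl deg_idp.
have h2 : p = (a, idp L (src a)).
  by apply: puniq => /=; rewrite rg_idp comp_idr deg_idp.
by move: h1; rewrite h2 => -[].
Qed.

Definition vpath k (L : kgraph k) (v : vtx L) (n : 'rV[nat]_k) : Type :=
  {a : mor L | (rg a == v) && (deg a == n)}.

HB.instance Definition _ k (L : kgraph k) v n :=
  Countable.on (@vpath k L v n).

Definition row_finite k (L : kgraph k) :=
  forall (v : vtx L) (n : 'rV[nat]_k), finite_set [set: vpath v n].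

Definition no_sources k (L : kgraph k) :=
  forall (v : vtx L) (n : 'rV[nat]_k), [set: vpath v n] !=set0.

Definition nle k (p q : 'rV[nat]_k) : bool := [forall i, (p ord0 i <= q ord0 i)%N].

Lemma nle_refl k (p : 'rV[nat]_k) : nle p p.
Proof. by apply/forallP. Qed.

Lemma nle_trans k (p q t : 'rV[nat]_k) : nle p q -> nle q t -> nle p t.
Proof.
by move=> /forallP pq /forallP qt; apply/forallP => i; apply: leq_trans (qt i).
Qed.

Lemma nle_add k (m p q : 'rV[nat]_k) : nle p q -> nle (p + m) (q + m).
Proof. by move=> /forallP pq; apply/forallP => i; rewrite !mxE leq_add2r. Qed.

(* Maps {(p, q) : p <= q in N^l} -> Gamma on morphisms; the comparison proof is
   boolean, so it is irrelevant. *)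
Definition premorph l (G : kgraph l) : Type :=
  forall p q : 'rV[nat]_l, nle p q -> mor G.

Definition xvtx l (G : kgraph l) (x : premorph G) (n : 'rV[nat]_l) : vtx G :=
  rg (x n n (nle_refl n)).

(* [p + deg _ = q] says that the degree is q - p, which is not available in
   'rV[nat]_l. *)
Record infinite_path l (G : kgraph l) (x : premorph G) : Prop := InfinitePath {
  inf_id : forall p, x p p (nle_refl p) = idp G (xvtx x p);
  inf_rg : forall p q (pq : nle p q), rg (x p q pq) = xvtx x p;
  inf_src : forall p q (pq : nle p q), src (x p q pq) = xvtx x q;
  inf_comp : forall p q t (pq : nle p q) (qt : nle q t),
    x p t (nle_trans pq qt) = kcomp G (x p q pq) (x q t qt);
  inf_deg : forall p q (pq : nle p q), p + deg (x p q pq) = q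
}.

Definition shift l (G : kgraph l) (m : 'rV[nat]_l) (x : premorph G) :
    premorph G :=
  fun p q pq => x (p + m) (q + m) (nle_add m pq).

Definition cofinal l (G : kgraph l) :=
  forall (v : vtx G) (x : premorph G), infinite_path x ->
    exists (n : 'rV[nat]_l) (a : mor G), rg a = v /\ src a = xvtx x n.

Definition aperiodic l (G : kgraph l) :=
  forall v : vtx G, exists x : premorph G,
    [/\ infinite_path x, xvtx x 0 = v &
        forall m n : 'rV[nat]_l, m <> n -> shift m x <> shift n x].

(* Formal (non-unital) R-algebra expressions in the generators. The generators
   [tS a], [tSt a] are kept for all morphisms a; the convention
   s_v = s_{v^*} = p_v is imposed by [kp_sv] and [kp_stv] below. That the
   quotient by [kpeq] is the universal algebra of the Kumjian-Pask relations is
   [KP_familyP] and [KP_universal]. *)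
Inductive kpterm (R : comPzRingType) k (L : kgraph k) : Type :=
| tP of vtx L
| tS of mor L
| tSt of mor L
| t0
| tadd of kpterm R L & kpterm R L
| topp of kpterm R L
| tscale of R & kpterm R L
| tmul of kpterm R L & kpterm R L.

Arguments tP {R k L}.
Arguments tS {R k L}.
Arguments tSt {R k L}.
Arguments t0 {R k L}.

(* In [kp4], e enumerates the finite set v L^n. *)
Inductive kpeq (R : comPzRingType) k (L : kgraph k) :
  kpterm R L -> kpterm R L -> Prop :=
| kp_refl t : kpeq t t
| kp_sym t u : kpeq t u -> kpeq u t
| kp_trans t u w : kpeq t u -> kpeq u w -> kpeq t w
| kp_add t t' u u' : kpeq t t' -> kpeq u u' -> kpeq (tadd t u) (tadd t' u')
| kp_opp t t' : kpeq t t' -> kpeq (topp t) (topp t')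
| kp_scale c t t' : kpeq t t' -> kpeq (tscale c t) (tscale c t')
| kp_mul t t' u u' : kpeq t t' -> kpeq u u' -> kpeq (tmul t u) (tmul t' u')
| kp_addA t u w : kpeq (tadd t (tadd u w)) (tadd (tadd t u) w)
| kp_addC t u : kpeq (tadd t u) (tadd u t)
| kp_add0 t : kpeq (tadd t0 t) t
| kp_addN t : kpeq (tadd (topp t) t) t0
| kp_scaleA c c' t : kpeq (tscale c (tscale c' t)) (tscale (c * c') t)
| kp_scale1 t : kpeq (tscale 1 t) t
| kp_scaleDr c t u : kpeq (tscale c (tadd t u)) (tadd (tscale c t) (tscale c u))
| kp_scaleDl c c' t :
    kpeq (tscale (c + c') t) (tadd (tscale c t) (tscale c' t))
| kp_mulA t u w : kpeq (tmul t (tmul u w)) (tmul (tmul t u) w)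
| kp_mulDl t u w : kpeq (tmul (tadd t u) w) (tadd (tmul t w) (tmul u w))
| kp_mulDr t u w : kpeq (tmul t (tadd u w)) (tadd (tmul t u) (tmul t w))
| kp_scaleAl c t u : kpeq (tscale c (tmul t u)) (tmul (tscale c t) u)
| kp_scaleAr c t u : kpeq (tscale c (tmul t u)) (tmul t (tscale c u))
| kp_sv v : kpeq (tS (idp L v)) (tP v)
| kp_stv v : kpeq (tSt (idp L v)) (tP v)
| kp1 v w : kpeq (tmul (tP v) (tP w)) (if v == w then tP v else t0)
| kp2_s a b : src a = rg b -> kpeq (tmul (tS a) (tS b)) (tS (kcomp L a b))
| kp2_st a b : src a = rg b -> kpeq (tmul (tSt b) (tSt a)) (tSt (kcomp L a b))
| kp2_ps a : kpeq (tmul (tP (rg a)) (tS a)) (tS a)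
| kp2_sp a : kpeq (tmul (tS a) (tP (src a))) (tS a)
| kp2_pst a : kpeq (tmul (tP (src a)) (tSt a)) (tSt a)
| kp2_stp a : kpeq (tmul (tSt a) (tP (rg a))) (tSt a)
| kp3 a b : deg a = deg b ->
    kpeq (tmul (tSt a) (tS b)) (if a == b then tP (src a) else t0)
| kp4 v (n : 'rV[nat]_k) (e : seq (vpath v n)) :
    n != 0 -> uniq e -> (forall a, a \in e) ->
    kpeq (tP v)
      (foldr (fun a t => tadd (tmul (tS (val a)) (tSt (val a))) t) t0 e).

Section KPQuotient.
Variables (R : comPzRingType) (k : nat) (L : kgraph k).

HB.instance Definition _ := gen_eqMixin (kpterm R L).
HB.instance Definition _ := gen_choiceMixin (kpterm R L).

Definition kprel (t u : kpterm R L) : bool := `[< kpeq t u >].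

Fact kprel_refl : reflexive kprel.
Proof. by move=> t; apply/asboolP/kp_refl. Qed.

Fact kprel_sym : symmetric kprel.
Proof. by move=> t u; apply/asboolP/asboolP => /kp_sym. Qed.

Fact kprel_trans : transitive kprel.
Proof.
by move=> t u w /asboolP ut /asboolP tw; apply/asboolP; apply: kp_trans tw.
Qed.

Canonical kprel_equiv := EquivRel kprel kprel_refl kprel_sym kprel_trans.

Definition KP : Type := {eq_quot kprel_equiv}.

HB.instance Definition _ := Choice.on KP.
HB.instance Definition _ := Quotient.on KP.

Lemma kp_piP (t u : kpterm R L) : \pi_KP t = \pi_KP u <-> kpeq t u.
Proof. by split=> [/eqmodP /asboolP|] // h; apply/eqmodP/asboolP. Qed.

Lemma kp_repr (t : kpterm R L) : kpeq (repr (\pi_KP t)) t.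
Proof. by apply/kp_piP; rewrite reprK. Qed.

Definition kpadd (x y : KP) : KP := \pi_KP (tadd (repr x) (repr y)).
Definition kpopp (x : KP) : KP := \pi_KP (topp (repr x)).
Definition kpscale (c : R) (x : KP) : KP := \pi_KP (tscale c (repr x)).
Definition kpmul (x y : KP) : KP := \pi_KP (tmul (repr x) (repr y)).

Lemma kpaddE t u : kpadd (\pi_KP t) (\pi_KP u) = \pi_KP (tadd t u).
Proof. by apply/kp_piP/kp_add; apply: kp_repr. Qed.

Lemma kpoppE t : kpopp (\pi_KP t) = \pi_KP (topp t).
Proof. by apply/kp_piP/kp_opp; apply: kp_repr. Qed.

Lemma kpscaleE c t : kpscale c (\pi_KP t) = \pi_KP (tscale c t).
Proof. by apply/kp_piP/kp_scale; apply: kp_repr. Qed.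

Lemma kpmulE t u : kpmul (\pi_KP t) (\pi_KP u) = \pi_KP (tmul t u).
Proof. by apply/kp_piP/kp_mul; apply: kp_repr. Qed.

Lemma kp_ind (P : KP -> Prop) : (forall t, P (\pi_KP t)) -> forall x, P x.
Proof. by move=> h x; rewrite -[x]reprK. Qed.

Fact kpaddA : associative kpadd.
Proof.
elim/kp_ind=> t; elim/kp_ind=> u; elim/kp_ind=> w.
by rewrite !kpaddE; apply/kp_piP/kp_addA.
Qed.

Fact kpaddC : commutative kpadd.
Proof.
by elim/kp_ind=> t; elim/kp_ind=> u; rewrite !kpaddE; apply/kp_piP/kp_addC.
Qed.

Fact kpadd0 : left_id (\pi_KP t0) kpadd.
Proof. by elim/kp_ind=> t; rewrite kpaddE; apply/kp_piP/kp_add0. Qed.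

Fact kpaddN : left_inverse (\pi_KP t0) kpopp kpadd.
Proof. by elim/kp_ind=> t; rewrite kpoppE kpaddE; apply/kp_piP/kp_addN. Qed.

HB.instance Definition _ :=
  GRing.isZmodule.Build KP kpaddA kpaddC kpadd0 kpaddN.

Fact kpscaleA c d x : kpscale c (kpscale d x) = kpscale (c * d) x.
Proof.
by elim/kp_ind: x => t; rewrite !kpscaleE; apply/kp_piP/kp_scaleA.
Qed.

Fact kpscale1 : left_id 1 kpscale.
Proof. by elim/kp_ind=> t; rewrite kpscaleE; apply/kp_piP/kp_scale1. Qed.

Fact kpscaleDr : right_distributive kpscale +%R.
Proof.
move=> c; elim/kp_ind=> t; elim/kp_ind=> u.
by rewrite [_ + _]kpaddE !kpscaleE [RHS]kpaddE; apply/kp_piP/kp_scaleDr.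
Qed.

Fact kpscaleDl x : {morph kpscale^~ x : c d / c + d}.
Proof.
move=> c d; elim/kp_ind: x => t.
by rewrite !kpscaleE [RHS]kpaddE; apply/kp_piP/kp_scaleDl.
Qed.

HB.instance Definition _ :=
  GRing.Zmodule_isLmodule.Build R KP kpscaleA kpscale1 kpscaleDr kpscaleDl.

Lemma kpmulA : associative kpmul.
Proof.
elim/kp_ind=> t; elim/kp_ind=> u; elim/kp_ind=> w.
by rewrite !kpmulE; apply/kp_piP/kp_mulA.
Qed.

Lemma kpmulDl : left_distributive kpmul +%R.
Proof.
elim/kp_ind=> t; elim/kp_ind=> u; elim/kp_ind=> w.
by rewrite [_ + _]kpaddE !kpmulE [RHS]kpaddE; apply/kp_piP/kp_mulDl.
Qed.

Lemma kpmulDr : right_distributive kpmul +%R.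
Proof.
elim/kp_ind=> t; elim/kp_ind=> u; elim/kp_ind=> w.
by rewrite [_ + _]kpaddE !kpmulE [RHS]kpaddE; apply/kp_piP/kp_mulDr.
Qed.

Lemma kpscaleAl (c : R) (x y : KP) : c *: kpmul x y = kpmul (c *: x) y.
Proof.
elim/kp_ind: x => t; elim/kp_ind: y => u.
by rewrite kpmulE ![c *: _]kpscaleE kpmulE; apply/kp_piP/kp_scaleAl.
Qed.

Lemma kpscaleAr (c : R) (x y : KP) : c *: kpmul x y = kpmul x (c *: y).
Proof.
elim/kp_ind: x => t; elim/kp_ind: y => u.
by rewrite kpmulE ![c *: _]kpscaleE kpmulE; apply/kp_piP/kp_scaleAr.
Qed.

Definition kp_p (v : vtx L) : KP := \pi_KP (tP v).
Definition kp_s (a : mor L) : KP := \pi_KP (tS a).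
Definition kp_st (a : mor L) : KP := \pi_KP (tSt a).

End KPQuotient.

Arguments kp_p {R k L}.
Arguments kp_s {R k L}.
Arguments kp_st {R k L}.
Arguments kpmul {R k L}.

Lemma fsbig_enum (V : nmodType) (T : choiceType) (e : seq T) (F : T -> V) :
  uniq e -> (forall a, a \in e) ->
  \sum_(a \in [set: T]) F a = \sum_(a <- e) F a.
Proof.
move=> ue ee; have -> : [set: T] = [set` e].
  by apply/seteqP; split=> a //= _; rewrite ee.
by rewrite -fsbig_seq.
Qed.

Lemma finite_enum (T : choiceType) : finite_set [set: T] ->
  exists e : seq T, uniq e /\ forall a, a \in e.
Proof.
move=> finT; exists (fset_set [set: T]); split; first exact: fset_uniq.
by move=> a; rewrite in_fset_set // inE.
Qed.

(* The R-algebra is given by its module B and its product mul because it need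
   not be unital. *)
Record KP_family (R : comPzRingType) k (L : kgraph k) (B : lmodType R)
    (mul : B -> B -> B) (p : vtx L -> B) (s st : mor L -> B) : Prop := {
  fam_sv : forall v, s (idp L v) = p v;
  fam_stv : forall v, st (idp L v) = p v;
  fam_kp1 : forall v w, mul (p v) (p w) = if v == w then p v else 0;
  fam_kp2_s : forall a b, src a = rg b -> mul (s a) (s b) = s (kcomp L a b);
  fam_kp2_st : forall a b, src a = rg b ->
    mul (st b) (st a) = st (kcomp L a b);
  fam_kp2_ps : forall a, mul (p (rg a)) (s a) = s a;
  fam_kp2_sp : forall a, mul (s a) (p (src a)) = s a;
  fam_kp2_pst : forall a, mul (p (src a)) (st a) = st a;
  fam_kp2_stp : forall a, mul (st a) (p (rg a)) = st a;
  fam_kp3 : forall a b, deg a = deg b ->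
    mul (st a) (s b) = if a == b then p (src a) else 0;
  fam_kp4 : forall v (n : 'rV[nat]_k), n != 0 ->
    p v = \sum_(a \in [set: vpath v n]) mul (s (val a)) (st (val a))
}.

Lemma KP_familyP (R : comPzRingType) k (L : kgraph k) : row_finite L ->
  KP_family (@kpmul R k L) kp_p kp_s kp_st.
Proof.
move=> rf; split; rewrite /kp_p /kp_s /kp_st.
- by move=> v; apply/kp_piP/kp_sv.
- by move=> v; apply/kp_piP/kp_stv.
- move=> v w; rewrite kpmulE; have /kp_piP -> := @kp1 R k L v w.
  by case: ifP.
- by move=> a b ab; rewrite kpmulE; apply/kp_piP/kp2_s.
- by move=> a b ab; rewrite kpmulE; apply/kp_piP/kp2_st.
- by move=> a; rewrite kpmulE; apply/kp_piP/kp2_ps.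
- by move=> a; rewrite kpmulE; apply/kp_piP/kp2_sp.
- by move=> a; rewrite kpmulE; apply/kp_piP/kp2_pst.
- by move=> a; rewrite kpmulE; apply/kp_piP/kp2_stp.
- move=> a b ab; rewrite kpmulE; have /kp_piP -> := @kp3 R k L a b ab.
  by case: ifP.
- move=> v n n0; have [e [ue ee]] := finite_enum (rf v n).
  have /kp_piP -> := @kp4 R k L v n e n0 ue ee.
  rewrite (fsbig_enum _ ue ee); elim: e {ue ee} => [|a e IH] /=.
    by rewrite big_nil.
  by rewrite big_cons -kpaddE IH -kpmulE.
Qed.

Theorem KP_universal (R : comPzRingType) k (L : kgraph k) (B : lmodType R)
    (mul : B -> B -> B) (p : vtx L -> B) (s st : mor L -> B) :
  associative mul -> left_distributive mul +%R -> right_distributive mul +%R ->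
  (forall c x y, c *: mul x y = mul (c *: x) y) ->
  (forall c x y, c *: mul x y = mul x (c *: y)) ->
  KP_family mul p s st ->
  exists! phi : KP R L -> B,
    [/\ linear phi, {morph phi : x y / kpmul x y >-> mul x y} &
        [/\ forall v, phi (kp_p v) = p v, forall a, phi (kp_s a) = s a &
            forall a, phi (kp_st a) = st a]].
Proof.
move=> mA mDl mDr mZl mZr [].
move=> fsv fstv f1 f2s f2st f2ps f2sp f2pst f2stp f3 f4.
pose ev := fix ev (t : kpterm R L) : B := match t with
  | tP v => p v | tS a => s a | tSt a => st a | t0 => 0
  | tadd t u => ev t + ev u | topp t => - ev t
  | tscale c t => c *: ev t | tmul t u => mul (ev t) (ev u) end.
have evP t u : kpeq t u -> ev t = ev u.
  elim=> //= {t u}; try by [move=> *; congruence].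
  - by move=> *; rewrite addrA.
  - by move=> *; rewrite addrC.
  - by move=> *; rewrite add0r.
  - by move=> *; rewrite addNr.
  - by move=> *; rewrite scalerA.
  - by move=> *; rewrite scale1r.
  - by move=> *; rewrite scalerDr.
  - by move=> *; rewrite scalerDl.
  - by move=> v w; rewrite f1; case: ifP.
  - by move=> a b ab; rewrite f3 //; case: ifP.
  - move=> v n e n0 ue ee; rewrite (f4 v n n0) (fsbig_enum _ ue ee).
    by elim: e {ue ee} => [|a e IH] /=; rewrite ?big_nil // big_cons IH.
have evE t : ev (repr (\pi_(KP R L) t)) = ev t by apply: evP; apply: kp_repr.
exists (fun x => ev (repr x)); split.
  split; [|by move=> x y; rewrite evE|by split=> v; rewrite evE].
  move=> c; elim/kp_ind=> t; elim/kp_ind=> u.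
  by rewrite [c *: \pi_(KP R L) t]kpscaleE [_ + _]kpaddE !evE.
move=> phi [lphi mphi [phip phis phist]]; apply/funext.
have phiD x y : phi (x + y) = phi x + phi y.
  by have := lphi 1 x y; rewrite !scale1r.
have phi0 : phi 0 = 0 by apply: (addrI (phi 0)); rewrite -phiD !addr0.
have phiZ c x : phi (c *: x) = c *: phi x.
  by have := lphi c x 0; rewrite phi0 !addr0.
elim/kp_ind=> t; rewrite evE; elim: t => /=.
- by move=> v; rewrite -phip.
- by move=> a; rewrite -phis.
- by move=> a; rewrite -phist.
- by rewrite -[LHS]phi0.
- by move=> t -> u ->; rewrite -phiD [X in phi X = _]kpaddE.
- move=> t ->; rewrite -kpoppE -[kpopp _]/(- (\pi_(KP R L) t)).
  by apply: (addrI (phi (\pi_(KP R L) t))); rewrite -phiD !subrr phi0.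
- by move=> c t ->; rewrite -phiZ [X in phi X = _]kpscaleE.
- by move=> t -> u ->; rewrite -mphi kpmulE.
Qed.

(* KP_R(L) when L has finitely many vertices: the same module and product, as a
   unital ring with 1 = \sum_v p_v. (For L without vertices this is the zero
   ring, which is why the structure is that of a pzRingType.) *)
Definition uKP (R : comPzRingType) k (L : kgraph k)
  (fin : finite_set [set: vtx L]) : Type := KP R L.

Section UnitalKP.
Variables (R : comPzRingType) (k : nat) (L : kgraph k).
Variable fin : finite_set [set: vtx L].

HB.instance Definition _ := GRing.Lmodule.on (uKP R fin).

Definition ukp_one : uKP R fin := \sum_(v \in [set: vtx L]) (kp_p v : KP R L).

Let kpmul0l x : kpmul (0 : KP R L) x = 0.
Proof. by apply: (addrI (kpmul 0 x)); rewrite -kpmulDl !addr0. Qed.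

Let kpmul0r x : kpmul x (0 : KP R L) = 0.
Proof. by apply: (addrI (kpmul x 0)); rewrite -kpmulDr !addr0. Qed.

Let kp_one_gen (e : seq (vtx L)) : uniq e -> (forall v, v \in e) ->
  forall x : KP R L, kpmul (\sum_(v <- e) kp_p v) x = x /\
                     kpmul x (\sum_(v <- e) kp_p v) = x.
Proof.
move=> ue ee.
have suml (x : KP R L) :
     kpmul (\sum_(v <- e) kp_p v) x = \sum_(v <- e) kpmul (kp_p v) x.
  exact: (big_morph (kpmul^~ x) (fun y z => kpmulDl y z x) (kpmul0l x)).
have sumr (x : KP R L) :
     kpmul x (\sum_(v <- e) kp_p v) = \sum_(v <- e) kpmul x (kp_p v).
  exact: (big_morph (kpmul x) (fun y z => kpmulDr x y z) (kpmul0r x)).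
have pp v w : kpmul (kp_p v) (kp_p w) = if v == w then kp_p v else 0 :> KP R L.
  by rewrite [LHS]kpmulE; have /kp_piP -> := @kp1 R k L v w; case: ifP.
have el w (y : KP R L) : kpmul (kp_p w) y = y ->
    kpmul (\sum_(v <- e) kp_p v) y = y.
  move=> wy; rewrite -{1}wy kpmulA suml (bigD1_seq w) //= pp eqxx big1 ?addr0 //.
  by move=> v /negbTE vw; rewrite pp vw.
have er w (y : KP R L) : kpmul y (kp_p w) = y ->
    kpmul y (\sum_(v <- e) kp_p v) = y.
  move=> wy; rewrite -{1}wy -kpmulA sumr (bigD1_seq w) //= pp eqxx big1 ?addr0 //.
  by move=> v /negbTE vw; rewrite pp eq_sym vw.
elim/kp_ind; elim.
- by move=> v; split; [apply: (el v)|apply: (er v)]; rewrite pp eqxx.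
- move=> a; split; [apply: (el (rg a))|apply: (er (src a))].
    by rewrite kpmulE; apply/kp_piP/kp2_ps.
  by rewrite kpmulE; apply/kp_piP/kp2_sp.
- move=> a; split; [apply: (el (src a))|apply: (er (rg a))].
    by rewrite kpmulE; apply/kp_piP/kp2_pst.
  by rewrite kpmulE; apply/kp_piP/kp2_stp.
- by split; rewrite ?kpmul0l ?kpmul0r.
- by move=> t [t1 t2] u [u1 u2]; rewrite -kpaddE kpmulDl kpmulDr t1 t2 u1 u2.
- move=> t [t1 t2]; rewrite -kpoppE -[kpopp _]/(- (_ : KP R L)).
  by rewrite -scaleN1r -kpscaleAl -kpscaleAr t1 t2.
- move=> c t [t1 t2]; rewrite -kpscaleE -[kpscale _ _]/(_ *: (_ : KP R L)).
  by rewrite -kpscaleAl -kpscaleAr t1 t2.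
- by move=> t [t1 t2] u [u1 u2]; rewrite -kpmulE kpmulA t1 -kpmulA u2.
Qed.

Fact ukp_mul1 : left_id ukp_one kpmul.
Proof.
have [e [ue ee]] := finite_enum fin.
by move=> x; rewrite /ukp_one (fsbig_enum _ ue ee); case: (kp_one_gen ue ee x).
Qed.

Fact ukp_mulr1 : right_id ukp_one kpmul.
Proof.
have [e [ue ee]] := finite_enum fin.
by move=> x; rewrite /ukp_one (fsbig_enum _ ue ee); case: (kp_one_gen ue ee x).
Qed.

HB.instance Definition _ := GRing.Zmodule_isPzRing.Build (uKP R fin)
  (@kpmulA R k L) ukp_mul1 ukp_mulr1 (@kpmulDl R k L) (@kpmulDr R k L).

End UnitalKP.

Definition center (A : pzRingType) : set A :=
  [set z | forall x, z * x = x * z].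

Arguments center : clear implicits.

(* Finitely supported functions G -> R, with basis u_g = << g >>. (The product
   on malg provided by monalg excludes nontrivial groups.) *)
Definition grpalg (R : comNzRingType) (G : zmodType) : Type := {malg R[G]}.

Section GroupAlgebra.
Variables (R : comNzRingType) (G : zmodType).
Local Notation A := (grpalg R G).

HB.instance Definition _ := GRing.Lmodule.on A.

Definition gbasis (g : G) : A := << g >>.

Definition gamul (a b : A) : A :=
  \sum_(g <- msupp a) \sum_(h <- msupp b) << a@_g * b@_h *g (g + h) >>.

Let gamulw (d1 d2 : {fset G}) (a b : A) :
  (msupp a `<=` d1)%fset -> (msupp b `<=` d2)%fset ->
  gamul a b = \sum_(g <- d1) \sum_(h <- d2) << a@_g * b@_h *g (g + h) >>.
Proof.
move=> le1 le2; rewrite /gamul (big_fset_incl _ le1) /=.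
  apply/eq_bigr=> g _; apply/big_fset_incl => // h _ /mcoeff_outdom ->.
  by rewrite mulr0 monalgU0.
move=> g _ /mcoeff_outdom ag.
by rewrite big1 => // h _; rewrite ag mul0r monalgU0.
Qed.

Fact gamulDl : left_distributive gamul +%R.
Proof.
move=> a b c; rewrite (gamulw (msuppD_le a b) (fsubset_refl _)).
rewrite [in RHS](gamulw (fsubsetUl _ (msupp b)) (fsubset_refl _)).
rewrite [in RHS](gamulw (fsubsetUr (msupp a) _) (fsubset_refl _)).
rewrite -big_split /=; apply/eq_bigr=> g _.
rewrite -big_split /=; apply/eq_bigr=> h _.
by rewrite mcoeffD mulrDl monalgUD.
Qed.

Fact gamulC : commutative gamul.
Proof.
move=> a b; rewrite /gamul exchange_big /=; apply/eq_bigr=> g _.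
by apply/eq_bigr=> h _; rewrite mulrC addrC.
Qed.

Fact gamulDr : right_distributive gamul +%R.
Proof. by move=> a b c; rewrite gamulC gamulDl ![gamul _ a]gamulC. Qed.

Lemma gamulUU c1 c2 g1 g2 :
  gamul << c1 *g g1 >> << c2 *g g2 >> = << c1 * c2 *g (g1 + g2) >>.
Proof. by rewrite (gamulw msuppU_le msuppU_le) !big_seq_fset1 !mcoeffUU. Qed.

Fact gamul0 a : gamul 0 a = 0.
Proof. by rewrite /gamul msupp0 big_seq_fset0. Qed.

Lemma grpalg_ind (P : A -> Prop) :
  P 0 -> (forall a b, P a -> P b -> P (a + b)) ->
  (forall c g, P << c *g g >>) -> forall a, P a.
Proof.
move=> P0 PD PU a; rewrite [a]monalgE.
by apply: (big_ind P) => // g _; apply: PU.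
Qed.

Fact gamulA : associative gamul.
Proof.
elim/grpalg_ind => [|a b IHa IHb|c1 g1] y z; first by rewrite !gamul0.
  by rewrite !gamulDl IHa IHb.
elim/grpalg_ind: y => [|a b IHa IHb|c2 g2].
- by rewrite gamul0 gamulC gamul0 gamul0.
- by rewrite gamulDl gamulDr IHa IHb gamulDr gamulDl.
elim/grpalg_ind: z => [|a b IHa IHb|c3 g3].
- by rewrite ![gamul _ 0]gamulC !gamul0 gamulC gamul0.
- by rewrite !gamulDr IHa IHb.
by rewrite !gamulUU mulrA addrA.
Qed.

Fact gamul1 : left_id (gbasis 0) gamul.
Proof.
elim/grpalg_ind => [|a b IHa IHb|c g]; first by rewrite gamulC gamul0.
  by rewrite gamulDr IHa IHb.
by rewrite gamulUU mul1r add0r.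
Qed.

Fact gaone_neq0 : gbasis 0 != 0.
Proof. by apply/eqP/malgP=> /(_ 0) /eqP; rewrite mcoeffUU mcoeff0 oner_eq0. Qed.

HB.instance Definition _ := GRing.Zmodule_isComNzRing.Build A
  gamulA gamulC gamul1 gamulDl gaone_neq0.

Fact gascaleAl (c : R) (a b : A) : c *: (a * b) = (c *: a) * b.
Proof.
elim/grpalg_ind: a => [|a a' IHa IHa'|c1 g1].
- by rewrite mul0r !scaler0 mul0r.
- by rewrite mulrDl !scalerDr mulrDl IHa IHa'.
elim/grpalg_ind: b => [|b b' IHb IHb'|c2 g2].
- by rewrite !mulr0 scaler0.
- by rewrite !mulrDr scalerDr IHb IHb'.
have sU d (h : G) : c *: (<< d *g h >> : A) = << c * d *g h >>.
  by apply/malgP=> i; rewrite mcoeffZ !mcoeffU mulrnAr.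
have mU d d' (h h' : G) : (<< d *g h >> : A) * (<< d' *g h' >> : A) =
    << d * d' *g (h + h') >> by exact: gamulUU.
by rewrite sU !mU sU mulrA.
Qed.

HB.instance Definition _ := GRing.Lmodule_isLalgebra.Build R A gascaleAl.
HB.instance Definition _ := GRing.Lalgebra_isComAlgebra.Build R A.

End GroupAlgebra.

Section Pullback.
Variables (k l : nat) (f : {additive 'rV[nat]_k -> 'rV[nat]_l}) (G : kgraph l).

Definition pbmor : Type := {x : mor G * 'rV[nat]_k | deg x.1 == f x.2}.

HB.instance Definition _ := Countable.on pbmor.

Fact pb_idp_subproof (v : vtx G) : deg (idp G v) == f 0.
Proof. by rewrite deg_idp raddf0. Qed.

Definition pb_rg (x : pbmor) : vtx G := rg (val x).1.
Definition pb_src (x : pbmor) : vtx G := src (val x).1.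
Definition pb_deg (x : pbmor) : 'rV[nat]_k := (val x).2.
Definition pb_idp (v : vtx G) : pbmor :=
  exist _ (idp G v, 0) (pb_idp_subproof v).
(* The default x of [insubd] is only returned for non-composable pairs. *)
Definition pb_comp (x y : pbmor) : pbmor :=
  insubd x (kcomp G (val x).1 (val y).1, (val x).2 + (val y).2).

Lemma pb_compE x y : pb_src x = pb_rg y ->
  val (pb_comp x y) = (kcomp G (val x).1 (val y).1, (val x).2 + (val y).2).
Proof.
move=> xy; rewrite val_insubd /= deg_comp // raddfD.
by rewrite (eqP (valP x)) (eqP (valP y)) eqxx.
Qed.

Fact pb_rg_comp x y : pb_src x = pb_rg y -> pb_rg (pb_comp x y) = pb_rg x.
Proof. by move=> xy; rewrite /pb_rg pb_compE //= rg_comp. Qed.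

Fact pb_src_comp x y : pb_src x = pb_rg y -> pb_src (pb_comp x y) = pb_src y.
Proof. by move=> xy; rewrite /pb_src pb_compE //= src_comp. Qed.

Fact pb_comp_idl x : pb_comp (pb_idp (pb_rg x)) x = x.
Proof.
apply: val_inj; rewrite pb_compE /pb_src /pb_rg /= ?src_idp //.
by rewrite comp_idl add0r; case: (val x).
Qed.

Fact pb_comp_idr x : pb_comp x (pb_idp (pb_src x)) = x.
Proof.
apply: val_inj; rewrite pb_compE /pb_src /pb_rg /= ?rg_idp //.
by rewrite comp_idr addr0; case: (val x).
Qed.

Fact pb_compA x y z : pb_src x = pb_rg y -> pb_src y = pb_rg z ->
  pb_comp x (pb_comp y z) = pb_comp (pb_comp x y) z.
Proof.
move=> xy yz; apply: val_inj; rewrite !pb_compE ?pb_rg_comp ?pb_src_comp //=.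
by rewrite kcompA // addrA.
Qed.

Fact pb_deg_comp x y :
  pb_src x = pb_rg y -> pb_deg (pb_comp x y) = pb_deg x + pb_deg y.
Proof. by move=> xy; rewrite /pb_deg pb_compE. Qed.

Fact pb_fact x (m n : 'rV[nat]_k) : pb_deg x = m + n ->
  exists! yz : pbmor * pbmor,
    [/\ pb_src yz.1 = pb_rg yz.2, x = pb_comp yz.1 yz.2, pb_deg yz.1 = m
      & pb_deg yz.2 = n].
Proof.
move=> xmn; have dx : deg (val x).1 = f m + f n.
  by rewrite (eqP (valP x)) -raddfD -xmn.
have [[b c] [[/= bc xbc db dc] uniq_bc]] := kfact dx.
have bP : deg (b, m).1 == f (b, m).2 by rewrite /= db.
have cP : deg (c, n).1 == f (c, n).2 by rewrite /= dc.
exists (exist _ (b, m) bP, exist _ (c, n) cP); split.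
  split=> //; apply: val_inj; rewrite pb_compE //= -xbc -xmn.
  by rewrite /pb_deg -surjective_pairing.
case=> [y z] [/= yz xyz dy dz].
have ebc : (b, c) = ((val y).1, (val z).1).
  apply: uniq_bc.
  split=> //=; first by rewrite xyz pb_compE.
    by rewrite (eqP (valP y)) -dy.
  by rewrite (eqP (valP z)) -dz.
case: ebc => eb ec; congr pair; apply: val_inj => /=.
  by rewrite eb -dy /pb_deg -surjective_pairing.
by rewrite ec -dz /pb_deg -surjective_pairing.
Qed.

Definition pullback : kgraph k :=
  @KGraph k (vtx G) pbmor pb_rg pb_src pb_idp pb_comp pb_deg
    (@rg_idp _ G) (@src_idp _ G) pb_rg_comp pb_src_comp pb_comp_idl pb_comp_idr
    pb_compA (fun=> erefl) pb_deg_comp pb_fact.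

End Pullback.

Section KernelGroup.
Variables (k l : nat) (f : {additive 'rV[nat]_k -> 'rV[nat]_l}).

Definition toZ m (v : 'rV[nat]_m) : 'rV[int]_m := map_mx Posz v.

Definition posp m (h : 'rV[int]_m) : 'rV[nat]_m :=
  \row_i `|Num.max (h ord0 i) 0%R|%N.
Definition negp m (h : 'rV[int]_m) : 'rV[nat]_m :=
  \row_i `|Num.max (- h ord0 i)%R 0%R|%N.

(* The group completion of f; [fbar_toZ] and [fbarB] characterise it as the
   additive map extending f. *)
Definition fbar (h : 'rV[int]_k) : 'rV[int]_l := toZ (f (posp h)) - toZ (f (negp h)).

Lemma toZD m (u v : 'rV[nat]_m) : toZ (u + v) = toZ u + toZ v.
Proof. by apply/rowP=> i; rewrite !mxE PoszD. Qed.

Lemma toZ_inj m : injective (@toZ m).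
Proof. by move=> u v /rowP uv; apply/rowP=> i; have := uv i; rewrite !mxE => -[]. Qed.

Lemma posnegE m (h : 'rV[int]_m) : h = toZ (posp h) - toZ (negp h).
Proof.
apply/rowP=> i; rewrite !mxE; case: (h 0 i) => n.
  by rewrite (max_idPl _) // (max_idPr _) ?oppr_le0 //= subr0.
by rewrite (max_idPr _) // (max_idPl _) //= sub0r.
Qed.

Lemma fbarE (u v : 'rV[nat]_k) : fbar (toZ u - toZ v) = toZ (f u) - toZ (f v).
Proof.
set h := toZ u - toZ v; have hE := posnegE h.
have e : u + negp h = posp h + v.
  apply: toZ_inj; rewrite !toZD; apply/eqP.
  by rewrite -subr_eq addrAC -/h {1}hE subrK.
rewrite /fbar; apply/eqP; rewrite subr_eq addrAC eq_sym subr_eq -!toZD.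
by rewrite -!raddfD e.
Qed.

Lemma fbar_toZ (u : 'rV[nat]_k) : fbar (toZ u) = toZ (f u).
Proof.
have z0 m : toZ (0 : 'rV_m) = 0 by apply/rowP=> i; rewrite !mxE.
by have := fbarE u 0; rewrite raddf0 !z0 !subr0.
Qed.

Lemma fbarB : {morph fbar : g h / g - h}.
Proof.
move=> g h.
have -> : g - h = toZ (posp g + negp h) - toZ (negp g + posp h).
  by rewrite {1}[g]posnegE {1}[h]posnegE !toZD opprB opprD addrACA.
by rewrite fbarE /fbar !(raddfD f) !toZD opprB opprD addrACA.
Qed.

Definition kerf : {pred 'rV[int]_k} := [pred h | fbar h == 0].

Fact kerf_zmod_closed : zmod_closed kerf.
Proof.
split; first by rewrite inE -(subrr (0 : 'rV_k)) fbarB subrr.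
by move=> g h; rewrite !inE fbarB => /eqP-> /eqP->; rewrite subrr.
Qed.

HB.instance Definition _ := GRing.isZmodClosed.Build _ kerf kerf_zmod_closed.

Record kergrp : Type := KerGrp { kval : 'rV[int]_k; kvalP : kval \in kerf }.

HB.instance Definition _ := [isSub for kval].
HB.instance Definition _ := [Choice of kergrp by <:].
HB.instance Definition _ := [SubChoice_isSubZmodule of kergrp by <:].

Lemma ker_posneg (h : kergrp) : f (posp (kval h)) = f (negp (kval h)).
Proof. by apply: toZ_inj; apply/eqP; rewrite -subr_eq0; have := kvalP h. Qed.

End KernelGroup.

Section CentralElements.
Variables (K : fieldType) (k l : nat).
Variables (f : {additive 'rV[nat]_k -> 'rV[nat]_l}) (G : kgraph l).
Variable fin : finite_set [set: vtx G].

(* KP_K(f^* Gamma); the vertices of the pullback are those of Gamma. *)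
Definition KPpb : Type := @uKP K k (pullback f G) fin.

HB.instance Definition _ := GRing.PzRing.on KPpb.
HB.instance Definition _ := GRing.Lmodule.on KPpb.

Variable h : kergrp f.

Fact pb_pos_subproof v (a : @vpath l G v (f (posp (kval h)))) :
  deg (val a) == f (posp (kval h)).
Proof. by case/andP: (valP a). Qed.

Fact pb_neg_subproof v (a : @vpath l G v (f (posp (kval h)))) :
  deg (val a) == f (negp (kval h)).
Proof. by rewrite -ker_posneg pb_pos_subproof. Qed.

Definition pb_pos v (a : vpath v (f (posp (kval h)))) : mor (pullback f G) :=
  exist _ (val a, posp (kval h)) (pb_pos_subproof a).
Definition pb_neg v (a : vpath v (f (posp (kval h)))) : mor (pullback f G) :=
  exist _ (val a, negp (kval h)) (pb_neg_subproof a).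

Definition Uelt : KPpb :=
  \sum_(v \in [set: vtx G]) \sum_(a \in [set: vpath v (f (posp (kval h)))])
    (kp_s (pb_pos a) : KPpb) * kp_st (pb_neg a).

End CentralElements.

Definition kp_iota (K : fieldType) (k l : nat)
    (f : {additive 'rV[nat]_k -> 'rV[nat]_l}) (G : kgraph l)
    (fin : finite_set [set: vtx G]) (x : grpalg K (kergrp f)) : KPpb K f fin :=
  \sum_(h <- msupp x) x@_h *: Uelt K fin h.

Arguments kp_iota {K k l f G} fin x.

(* Main.v *)
Require Import Defs.
From HB Require Import structures.
From mathcomp Require Import all_boot all_order all_algebra.
From mathcomp Require Import finmap monalg.
From mathcomp Require Import boolp classical_sets functions cardinality fsbigop.

Set Implicit Arguments.
Unset Strict Implicit.
Unset Printing Implicit Defensive.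

Import Order.TTheory GRing.Theory Num.Theory.

Local Open Scope classical_set_scope.
Local Open Scope ring_scope.

(** KP(f^* G) acts faithfully on a space of functions, and everything is read
    off from this action. The functions are those of pairs (x, t), where x is
    an infinite path of G and t is in Z^k. On the indicator function of (y,
    t), the generator s_(a, n) moves y to a y and t to t + n, and its ghost
    undoes this; the Kumjian-Pask relations hold because every path has a
    unique initial segment of each degree ([rep_family]).

    Faithfulness ([rep_inj_delta]) comes from two remarks. An element u with u
    s_b = 0 for all b of some fixed degree is zero, by (KP4). And for b long
    enough, u s_b is a combination of elements s_a with a and b of equal
    source ([uKP_span]); its coefficients are visible in the action, since the
    second coordinate t separates morphisms of different degrees in N^k
    ([rep_mlin_coef]).

    Under this action U_h becomes the translation of t by h ([rep_Uelt]), and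
    all operators of the representation commute with translations
    ([translation_rep]). So the U_h are central and multiply like the elements
    of H, and they are linearly independent because translates of an indicator
    function are.

    For the center, let z be central. As z commutes with the projections s_a
    s_{a*}, it preserves the support of functions in the path coordinate
    ([central_diag]): z sends the indicator of (y, 0) to a combination of the
    indicators of the points (y, t), with coefficients c(y, t). Write z s_b,
    for b long, as a combination of elements s_a. Then a y = b y for all y,
    and an aperiodic y forces a and b to have the same base morphism
    ([aperiodic_eq]), so only t in H occur. The coefficients depend only on
    the initial segment b of the path ([coef_span]) and are invariant under
    adding or removing an initial segment ([coef_pcons]); by cofinality they
    do not depend on y at all ([coef_const]). Hence z is the sum of the c(t)
    U_t ([center_iota]). *)

(** * Unique factorisation and infinite paths *)

Lemma rVnat_addrI k (m : 'rV[nat]_k) : injective (+%R m).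
Proof.
move=> p q /rowP e; apply/rowP => i.
by have := e i; rewrite !mxE => /addnI.
Qed.

Section Factorisation.
Variables (k : nat) (L : kgraph k).
Implicit Types (a b c : mor L) (m n : 'rV[nat]_k).

Lemma fac_ex a m n : deg a = m + n ->
  exists b c, [/\ src b = rg c, a = kcomp L b c, deg b = m & deg c = n].
Proof. by move=> /kfact [[b c] [[h1 h2 h3 h4] _]]; exists b, c. Qed.

Lemma fac_inj a b c d : src a = rg b -> src c = rg d ->
  kcomp L a b = kcomp L c d -> deg a = deg c -> a = c /\ b = d.
Proof.
move=> ab cd e dac.
have db : deg b = deg d.
  apply: (@rVnat_addrI _ (deg a)); rewrite -deg_comp // e deg_comp //.
  by rewrite dac.
have [p [_ u]] := kfact (deg_comp ab).
have h1 : p = (a, b) by apply: u.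
have h2 : p = (c, d) by apply: u; split.
by move: h1; rewrite h2 => -[-> ->].
Qed.

(** The value is a default unless [deg a] dominates [m]. *)
Definition fac a m : mor L * mor L :=
  xget (a, a) [set bc | [/\ src bc.1 = rg bc.2, a = kcomp L bc.1 bc.2
                          & deg bc.1 = m]].

Lemma fac_comp b c : src b = rg c -> fac (kcomp L b c) (deg b) = (b, c).
Proof.
move=> bc; rewrite /fac; case: xgetP => [[b' c'] _ [/= h1 h2 h3]|].
  by have [-> ->] := fac_inj bc h1 h2 (esym h3).
by move=> /(_ (b, c)) /= [].
Qed.

Definition head a m := (fac a m).1.
Definition tail a m := (fac a m).2.

Lemma head_comp b c : src b = rg c -> head (kcomp L b c) (deg b) = b.
Proof. by move=> bc; rewrite /head fac_comp. Qed.

Lemma tail_comp b c : src b = rg c -> tail (kcomp L b c) (deg b) = c.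
Proof. by move=> bc; rewrite /tail fac_comp. Qed.

Lemma comp_injl a b b' : src a = rg b -> src a = rg b' ->
  kcomp L a b = kcomp L a b' -> b = b'.
Proof. by move=> ab ab' e; case: (fac_inj ab ab' e). Qed.

Definition initial b a := exists2 c, src b = rg c & a = kcomp L b c.

Lemma initial_refl a : initial a a.
Proof. by exists (idp L (src a)); rewrite ?rg_idp ?comp_idr. Qed.

Lemma initial_trans a b c : initial a b -> initial b c -> initial a c.
Proof.
move=> [d ad ->] [e]; rewrite src_comp // => de ->.
by exists (kcomp L d e); rewrite ?rg_comp ?kcompA.
Qed.

Lemma initial_uniq a b c : initial a c -> initial b c -> deg a = deg b -> a = b.
Proof. by move=> [d ad ->] [e be ce] ab; case: (fac_inj ad be ce ab). Qed.

End Factorisation.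

Section Paths.
Variables (l : nat) (G : kgraph l).
Implicit Types (a b c : mor G) (m n p : 'rV[nat]_l).

(** An infinite path is stored as the family of its initial segments: [x n]
    stands for the morphism x(0, n). Operators below act on functions of
    arbitrary families and vanish off the genuine paths, which avoids a
    subtype and partially defined operations. *)
Definition rawpath : Type := 'rV[nat]_l -> mor G.
Implicit Types x y : rawpath.

Record ipath x : Prop := IPath {
  ipath_deg : forall n, deg (x n) = n;
  ipath_prefix : forall m n, initial (x m) (x (m + n))
}.

Definition origin x : vtx G := rg (x 0).

(** The segment x(m, m + n) is what remains of [x (m + n)] once [x m] is split
    off; dually, the initial segments of a x are the initial segments of the
    morphisms a x(0, n), whose degrees are large enough. *)
Definition pshift m x : rawpath := fun n => tail (x (m + n)) m.
Definition pcons a x : rawpath := fun n => head (kcomp G a (x n)) n.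

Lemma ipath0 x : ipath x -> x 0 = idp G (origin x).
Proof. by move=> xp; apply: deg0_idp; rewrite ipath_deg. Qed.

Lemma ipath_rg x n : ipath x -> rg (x n) = origin x.
Proof.
move=> xp; have [c xc e] := ipath_prefix xp 0 n.
by rewrite -[n]add0r e rg_comp.
Qed.

Lemma ipath_split x m n : ipath x ->
  [/\ src (x m) = rg (pshift m x n), x (m + n) = kcomp G (x m) (pshift m x n)
    & deg (pshift m x n) = n].
Proof.
move=> xp; have [c xc e] := ipath_prefix xp m n.
have -> : pshift m x n = c.
  by rewrite /pshift e -{2}(ipath_deg xp m) tail_comp.
split=> //; apply: (@rVnat_addrI _ m).
by rewrite -(ipath_deg xp (m + n)) e deg_comp // ipath_deg.
Qed.

Lemma ipath_pshift m x : ipath x -> ipath (pshift m x).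
Proof.
move=> xp; split=> [n|n p]; first by have [] := ipath_split m n xp.
have [h1 h2 h3] := ipath_split m n xp.
have [h4 h5 h6] := ipath_split m (n + p) xp.
have [c h7 h8] := ipath_prefix xp (m + n) p.
have nc : src (pshift m x n) = rg c by rewrite -h7 h2 src_comp.
exists c => //; apply: (@comp_injl _ _ (x m)) => //; first by rewrite rg_comp.
by rewrite -h5 addrA h8 h2 kcompA.
Qed.

Lemma origin_pshift m x : ipath x -> origin (pshift m x) = src (x m).
Proof. by move=> xp; have [-> _ _] := ipath_split m 0 xp. Qed.

Lemma pshift0 x : ipath x -> pshift 0 x = x.
Proof.
move=> xp; apply/funext => n; have [h1 h2 _] := ipath_split 0 n xp.
have e := ipath0 xp.
rewrite -[RHS](congr1 x (add0r n)) h2 e.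
by have := comp_idl (pshift 0 x n); rewrite -h1 e src_idp.
Qed.

Lemma pshiftD m n x : ipath x -> pshift n (pshift m x) = pshift (m + n) x.
Proof.
move=> xp; apply/funext => p.
have [h1 h2 _] := ipath_split m n xp.
have [h3 h4 _] := ipath_split m (n + p) xp.
have [h5 h6 _] := ipath_split (m + n) p xp.
have [h7 h8 _] := ipath_split n p (ipath_pshift m xp).
apply: (@comp_injl _ _ (x (m + n))) => //; first by rewrite h2 src_comp.
by rewrite -h6 h2 -kcompA // -h8 -h4 addrA.
Qed.

Lemma pcons_split a x n : ipath x -> src a = origin x ->
  exists c, [/\ src (pcons a x n) = rg c,
    kcomp G a (x n) = kcomp G (pcons a x n) c & deg (pcons a x n) = n].
Proof.
move=> xp ax; have axn : src a = rg (x n) by rewrite ipath_rg.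
have : deg (kcomp G a (x n)) = n + deg a.
  by rewrite deg_comp // ipath_deg // addrC.
move=> /fac_ex [b [c [bc e db _]]]; exists c.
have -> // : pcons a x n = b by rewrite /pcons e -db head_comp.
Qed.

(** The value of a x at degree [deg b] is defined from a x(0, deg b), but any
    a x(0, n) that starts with [b] determines it. *)
Lemma pconsP a x b c n : ipath x -> src a = origin x -> src b = rg c ->
  kcomp G a (x n) = kcomp G b c -> pcons a x (deg b) = b.
Proof.
move=> xp ax bc e.
have axn p : src a = rg (x p) by rewrite ipath_rg.
(* Both are initial in a x(n + deg b), and they have the same degree. *)
have [h1 h2 _] := ipath_split n (deg b) xp.
have [h3 h4 _] := ipath_split (deg b) n xp.
have [d [h5 h6 h7]] := pcons_split (deg b) xp ax.
have cd : src c = rg (pshift n x (deg b)).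
  by rewrite -(src_comp bc) -e src_comp.
have da : src d = rg (pshift (deg b) x n).
  by rewrite -(src_comp h5) -h6 src_comp.
have E : kcomp G b (kcomp G c (pshift n x (deg b))) =
         kcomp G (pcons a x (deg b)) (kcomp G d (pshift (deg b) x n)).
  by rewrite !kcompA // -e -h6 -!kcompA // -h2 -h4 addrC.
by case: (fac_inj _ _ E); rewrite ?rg_comp ?h7.
Qed.

Lemma ipath_pcons a x : ipath x -> src a = origin x -> ipath (pcons a x).
Proof.
move=> xp ax; split=> [n|m n]; first by have [c []] := pcons_split n xp ax.
have [c [h1 h2 h3]] := pcons_split (m + n) xp ax.
have [b [d [bd e db _]]] := fac_ex h3.
have dc : src d = rg c by rewrite -h1 e src_comp.
have := @pconsP a x b (kcomp G d c) (m + n) xp ax.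
rewrite rg_comp // db => -> //; first by exists d.
by rewrite h2 e kcompA.
Qed.

Lemma pcons_head a x n : ipath x -> src a = origin x ->
  pcons a x (deg a + n) = kcomp G a (x n).
Proof.
move=> xp ax; have axn : src a = rg (x n) by rewrite ipath_rg.
have h := @pconsP a x (kcomp G a (x n)) (idp G (src (x n))) n xp ax.
have e : deg a + n = deg (kcomp G a (x n)) by rewrite deg_comp // ipath_deg.
rewrite e; apply: h; first by rewrite rg_idp src_comp.
by rewrite -(src_comp axn) comp_idr.
Qed.

Lemma pcons_deg a x : ipath x -> src a = origin x -> pcons a x (deg a) = a.
Proof.
move=> xp ax; have := pcons_head 0 xp ax.
by rewrite addr0 ipath0 // -ax comp_idr.
Qed.

Lemma origin_pcons a x : ipath x -> src a = origin x ->
  origin (pcons a x) = rg a.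
Proof.
move=> xp ax; rewrite -(ipath_rg (deg a)) ?pcons_deg //.
exact: ipath_pcons.
Qed.

Lemma pshift_pcons a x : ipath x -> src a = origin x ->
  pshift (deg a) (pcons a x) = x.
Proof.
move=> xp ax; apply/funext => n.
by rewrite /pshift pcons_head // tail_comp // ipath_rg.
Qed.

Lemma pcons_pshift m x : ipath x -> pcons (x m) (pshift m x) = x.
Proof.
move=> xp; apply/funext => n.
have [h1 h2 _] := ipath_split m n xp.
have [h3 h4 _] := ipath_split n m xp.
by rewrite /pcons -h2 addrC h4; have := head_comp h3; rewrite ipath_deg.
Qed.

(** A criterion for a path to be of the form a x; the composition law
    [pcons_comp] is one application. *)
Lemma pcons_uniq a x y : ipath y -> y (deg a) = a -> pshift (deg a) y = x ->
  y = pcons a x.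
Proof. by move=> yp e <-; rewrite -{1}e pcons_pshift. Qed.

Lemma pcons_comp a b x : ipath x -> src b = origin x -> src a = rg b ->
  pcons a (pcons b x) = pcons (kcomp G a b) x.
Proof.
move=> xp bx ab; have bp := ipath_pcons xp bx.
have abp : src a = origin (pcons b x) by rewrite origin_pcons.
apply: pcons_uniq; first exact: ipath_pcons.
  by rewrite deg_comp // pcons_head // pcons_deg.
rewrite deg_comp // -pshiftD; last exact: ipath_pcons.
by rewrite !pshift_pcons.
Qed.

Lemma pcons_idp x : ipath x -> pcons (idp G (origin x)) x = x.
Proof.
by move=> xp; rewrite -ipath0 //; have := pcons_pshift 0 xp; rewrite pshift0.
Qed.

Lemma ipath_comp x a b : ipath x -> src a = rg b ->
  x (deg a + deg b) = kcomp G a b <->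
  x (deg a) = a /\ pshift (deg a) x (deg b) = b.
Proof.
move=> xp ab; have [h1 h2 _] := ipath_split (deg a) (deg b) xp.
split=> [e|[e1 e2]]; last by rewrite h2 e1 e2.
rewrite h2 in e; have [] // := fac_inj h1 ab e.
by rewrite ipath_deg.
Qed.

End Paths.

(** * Existence of infinite paths, cofinality and aperiodicity *)

Lemma nle_addP k (p q : 'rV[nat]_k) : nle p q -> exists r, q = p + r.
Proof.
move=> /forallP pq; exists (\row_i (q ord0 i - p ord0 i)%N).
by apply/rowP => i; rewrite !mxE [RHS]subnKC //; apply: pq.
Qed.

Lemma nle_0 k (n : 'rV[nat]_k) : nle 0 n.
Proof. by apply/forallP => i; rewrite mxE. Qed.

(** Without sources, morphisms of degree (1, ..., 1) can be appended forever.
    The morphism obtained after j steps has degree (j, ..., j), so it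
    dominates n as soon as j is the sum of the coordinates of n, and its
    initial segment of degree n does not change afterwards. *)
Lemma ipath_exists l (G : kgraph l) : no_sources G ->
  forall v : vtx G, exists2 x : rawpath G, ipath x & origin x = v.
Proof.
move=> ns v; pose one : 'rV[nat]_l := const_mx 1%N.
have stepE (w : vtx G) : exists a : mor G, rg a = w /\ deg a = one.
  have [[a /andP[/eqP ra /eqP da]] _] := ns w one.
  by exists a.
have [step stepP] := boolp.choice stepE.
pose chain := fix chain j : mor G :=
  if j is j'.+1 then kcomp G (chain j') (step (src (chain j'))) else idp G v.
have chainS j : src (chain j) = rg (step (src (chain j))).
  by have [-> _] := stepP (src (chain j)).
have chain_deg j i : deg (chain j) ord0 i = j.
  elim: j => [|j IH]; first by rewrite /= deg_idp mxE.
  rewrite [chain _]/= deg_comp // mxE IH.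
  by have [_ ->] := stepP (src (chain j)); rewrite mxE [LHS]addn1.
have chain_le i j : (i <= j)%N -> initial (chain i) (chain j).
  move=> /subnK <-; elim: (j - i)%N => [|m IH]; first exact: initial_refl.
  apply: (initial_trans IH); rewrite addSn.
  by exists (step (src (chain (m + i)))).
pose len (n : 'rV[nat]_l) := (\sum_i n ord0 i)%N.
have chainP n : exists b, initial b (chain (len n)) /\ deg b = n.
  have /nle_addP [r] : nle n (deg (chain (len n))).
    by apply/forallP => i; rewrite chain_deg /len (bigD1 i) //= leq_addr.
  by move=> /fac_ex [b [c [bc e db _]]]; exists b; split=> //; exists c.
have [x xP] := boolp.choice chainP.
have xip : ipath x.
  split=> [n|m n]; first by have [] := xP n.
  have [h1 h2] := xP m; have [h3 h4] := xP (m + n).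
  have [b [c [bc e db _]]] := fac_ex h4.
  suff -> : x m = b by exists c.
  apply: (@initial_uniq _ _ _ _ (chain (len (m + n)))); last by rewrite h2.
    apply: (initial_trans h1); apply: chain_le.
    by apply: leq_sum => i _; rewrite mxE leq_addr.
  by apply: initial_trans h3; exists c.
exists x => //; have [[c xc e] _] := xP 0.
rewrite /origin -(rg_comp xc) -e.
have -> : len 0 = 0%N by rewrite /len big1 // => i _; rewrite mxE.
exact: rg_idp.
Qed.

Section Premorph.
Variables (l : nat) (G : kgraph l).

(** The two directions of the correspondence between families of initial
    segments and degree-preserving functors; they carry cofinality and
    aperiodicity over to [ipath]. *)
Definition path_premorph (x : rawpath G) : premorph G :=
  fun p q _ => tail (x q) p.

Definition premorph_path (y : premorph G) : rawpath G :=
  fun n => y 0 n (nle_0 n).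

Lemma path_premorphE (x : rawpath G) p r (h : nle p (p + r)) :
  path_premorph x h = pshift p x r.
Proof. by []. Qed.

Lemma xvtx_path_premorph x p : ipath x -> xvtx (path_premorph x) p = src (x p).
Proof.
move=> xp; rewrite /xvtx /path_premorph.
by rewrite -origin_pshift // /origin /pshift addr0.
Qed.

Lemma infinite_path_premorph x : ipath x -> infinite_path (path_premorph x).
Proof.
move=> xp; split=> [p|p q pq|p q pq|p q t pq qt|p q pq].
- rewrite xvtx_path_premorph // /path_premorph -origin_pshift //.
  by rewrite -ipath0 /pshift ?addr0 //; apply: ipath_pshift.
- rewrite xvtx_path_premorph //; have [r e] := nle_addP pq.
  by subst q; rewrite path_premorphE; have [] := ipath_split p r xp.
- rewrite xvtx_path_premorph //; have [r e] := nle_addP pq.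
  subst q; rewrite path_premorphE.
  by have [h1 -> _] := ipath_split p r xp; rewrite src_comp.
- have [r e] := nle_addP pq; have [s e'] := nle_addP qt.
  subst q; subst t; rewrite path_premorphE [X in kcomp G _ X]path_premorphE.
  rewrite /path_premorph -addrA.
  have [_ h _] := ipath_split r s (ipath_pshift p xp).
  by rewrite pshiftD // in h; rewrite -h.
- have [r e] := nle_addP pq; subst q.
  by rewrite path_premorphE; have [_ _ ->] := ipath_split p r xp.
Qed.

Lemma ipath_premorph_path y : infinite_path y -> ipath (premorph_path y).
Proof.
move=> yp; split=> [n|m n].
  by have := inf_deg yp (nle_0 n); rewrite add0r.
have mn : nle m (m + n).
  by apply/forallP => i; rewrite mxE leq_addr.
exists (y m (m + n) mn); first by rewrite (inf_rg yp) (inf_src yp).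
rewrite /premorph_path -(inf_comp yp).
by congr (y 0 (m + n) _); apply: bool_irrelevance.
Qed.

Lemma pshift_premorph_path y m n : infinite_path y ->
  pshift m (premorph_path y) = pshift n (premorph_path y) ->
  shift m y = shift n y.
Proof.
move=> yp e.
(* Both sides are the segment of y from p + m' to q + m'. *)
have seg m' p q (pq : nle p q) :
    shift m' y pq = tail (pshift m' (premorph_path y) q) p.
  rewrite /shift.
  have xp := ipath_premorph_path yp; set x := premorph_path y in xp *.
  have [r qE] := nle_addP pq; subst q.
  rewrite -[RHS]/(pshift p (pshift m' x) r) pshiftD //.
  have [h1 h2 _] := ipath_split (m' + p) r xp.
  have mp : nle (p + m') (p + r + m') := nle_add m' pq.
  apply: (@comp_injl _ _ (x (p + m'))).
  - by rewrite (inf_src yp) (inf_rg yp).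
  - by rewrite [p + m']addrC.
  have -> : kcomp G (x (p + m')) (pshift (m' + p) x r) = x (p + r + m').
    by rewrite [p + m']addrC -h2 -addrA addrC.
  rewrite /x /premorph_path -(inf_comp yp).
  by congr (y 0 _ _); apply: bool_irrelevance.
do 3 apply: functional_extensionality_dep => ?.
by rewrite !seg e.
Qed.

Lemma cofinal_ipath : cofinal G -> forall v (x : rawpath G), ipath x ->
  exists n (a : mor G), rg a = v /\ src a = origin (pshift n x).
Proof.
move=> cof v x xp; have [n [a [ra sa]]] := cof v _ (infinite_path_premorph xp).
by exists n, a; rewrite origin_pshift // -xvtx_path_premorph.
Qed.

Lemma aperiodic_ipath : aperiodic G -> forall v, exists x : rawpath G,
  [/\ ipath x, origin x = v & forall m n, pshift m x = pshift n x -> m = n].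
Proof.
move=> ap v; have [y [yp yv yap]] := ap v.
exists (premorph_path y); split; first exact: ipath_premorph_path.
  rewrite -yv /xvtx /origin /premorph_path.
  by congr (rg (y 0 0 _)); apply: bool_irrelevance.
move=> m n e; have [//|/eqP mn] := eqVneq m n.
by have := yap m n mn; rewrite (pshift_premorph_path yp e).
Qed.

End Premorph.

(** * Linear operators and linear combinations *)

Section LinearOperators.
Variables (K : comPzRingType) (V : lmodType K).

Definition linear_fun : {pred V -> V} := [pred T | `[< linear T >]].

Fact linear_fun_submod : submod_closed linear_fun.
Proof.
split=> [|c S T]; rewrite !inE.
  have z w : (0 : V -> V) w = 0 by [].
  by move=> c u v; rewrite !z scaler0 addr0.
move=> lS lT d u v.
have e w : (c *: S + T) w = c *: S w + T w by [].
rewrite !e lS lT !scalerDr !scalerA [c * d]mulrC.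
by rewrite addrACA.
Qed.

HB.instance Definition _ :=
  GRing.isSubmodClosed.Build K (V -> V) linear_fun linear_fun_submod.

(** Linear endomorphisms are collected in a type of their own because
    composition distributes over addition on the right only for linear maps. *)
Record linop : Type := LinOp { lfun :> V -> V; lfunP : lfun \in linear_fun }.

HB.instance Definition _ := [isSub for lfun].
HB.instance Definition _ := [Choice of linop by <:].
HB.instance Definition _ := [SubChoice_isSubZmodule of linop by <:].
HB.instance Definition _ := [SubZmodule_isSubLmodule of linop by <:].

Lemma linopP (S T : linop) : (forall u, S u = T u) <-> S = T.
Proof. by split=> [e|->//]; apply: val_inj; apply/funext. Qed.

Lemma linop_linear (T : linop) : linear T.
Proof. by have := lfunP T; rewrite inE. Qed.

Lemma linopD (T : linop) u v : T (u + v) = T u + T v.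
Proof. by have := linop_linear T 1 u v; rewrite !scale1r. Qed.

Lemma linop0 (T : linop) : T 0 = 0.
Proof. by apply: (addrI (T 0)); rewrite -linopD !addr0. Qed.

Lemma linopZ (T : linop) c u : T (c *: u) = c *: T u.
Proof. by have := linop_linear T c u 0; rewrite linop0 !addr0. Qed.

Fact linop_comp_subproof (S T : linop) : (S : V -> V) \o T \in linear_fun.
Proof. by rewrite inE => c u v /=; rewrite !linop_linear. Qed.

Definition linop_comp (S T : linop) : linop := LinOp (linop_comp_subproof S T).

Lemma linop_compE S T u : linop_comp S T u = S (T u).
Proof. by []. Qed.

Lemma linop_addE (S T : linop) u : (S + T) u = S u + T u.
Proof. by rewrite -[lfun _]/(val (S + T)) raddfD. Qed.

Lemma linop_scaleE c (S : linop) u : (c *: S) u = c *: S u.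
Proof. by rewrite -[lfun _]/(val (c *: S)) linearZ. Qed.

Lemma linop_0E u : (0 : linop) u = 0.
Proof. by rewrite -[lfun _]/(val 0) raddf0. Qed.

Lemma linop_compA : associative linop_comp.
Proof. by move=> S T U; apply/linopP. Qed.

Lemma linop_compDl : left_distributive linop_comp +%R.
Proof.
move=> S T U; apply/linopP => u.
by rewrite [RHS]linop_addE !linop_compE linop_addE.
Qed.

Lemma linop_compDr : right_distributive linop_comp +%R.
Proof.
move=> S T U; apply/linopP => u.
by rewrite [RHS]linop_addE !linop_compE linop_addE linopD.
Qed.

Lemma linop_compZl c S T : c *: linop_comp S T = linop_comp (c *: S) T.
Proof.
by apply/linopP => u; rewrite [LHS]linop_scaleE !linop_compE linop_scaleE.
Qed.

Lemma linop_compZr c S T : c *: linop_comp S T = linop_comp S (c *: T).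
Proof.
apply/linopP => u.
by rewrite [LHS]linop_scaleE !linop_compE linop_scaleE linopZ.
Qed.

End LinearOperators.

Section FreeModule.
Variables (K : comNzRingType) (T : choiceType) (V : lmodType K) (F : T -> V).

Definition mlin (g : {malg K[T]}) : V := \sum_(t <- msupp g) g@_t *: F t.

Lemma mlinw (d : {fset T}) g : (msupp g `<=` d)%fset ->
  mlin g = \sum_(t <- d) g@_t *: F t.
Proof.
move=> le; rewrite /mlin (big_fset_incl _ le) //= => t _ /mcoeff_outdom ->.
by rewrite scale0r.
Qed.

Lemma mlin_linear : linear mlin.
Proof.
move=> c g h; pose d := (msupp g `|` msupp h)%fset.
have sg : (msupp g `<=` d)%fset by apply: fsubsetUl.
have sh : (msupp h `<=` d)%fset by apply: fsubsetUr.
have s : (msupp (c *: g + h) `<=` d)%fset.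
  apply: fsubset_trans (msuppD_le _ _) _.
  by apply: fsetUSS => //; apply: msuppZ_le.
rewrite (mlinw sg) (mlinw sh) (mlinw s) scaler_sumr -big_split /=.
by apply: eq_bigr => t _; rewrite mcoeffD mcoeffZ scalerDl scalerA.
Qed.

Lemma mlin0 : mlin 0 = 0.
Proof. by rewrite /mlin msupp0 big_seq_fset0. Qed.

Lemma mlinD g h : mlin (g + h) = mlin g + mlin h.
Proof. by have := mlin_linear 1 g h; rewrite !scale1r. Qed.

Lemma mlinZ c g : mlin (c *: g) = c *: mlin g.
Proof. by have := mlin_linear c g 0; rewrite mlin0 !addr0. Qed.

Lemma mlinU t : mlin << t >> = F t.
Proof. by rewrite (mlinw msuppU_le) big_seq_fset1 mcoeffUU scale1r. Qed.

End FreeModule.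

(** * Kumjian-Pask algebras of k-graphs with finitely many vertices *)

Section KPAlgebra.
Variables (K : comNzRingType) (k : nat) (L : kgraph k).
Hypothesis rf : row_finite L.
Variable fin : finite_set [set: vtx L].
Local Notation A := (uKP K fin).
Implicit Types (a b c : mor L) (v w : vtx L) (x y z : A).

Let p v : A := kp_p v.
Let s a : A := kp_s a.
Let st a : A := kp_st a.

Lemma uKP_scaleAl (c : K) x y : c *: (x * y) = (c *: x) * y.
Proof. exact: kpscaleAl. Qed.

Lemma uKP_scaleAr (c : K) x y : c *: (x * y) = x * (c *: y).
Proof. exact: kpscaleAr. Qed.

Lemma uKP_ind (P : A -> Prop) :
  (forall v, P (p v)) -> (forall a, P (s a)) -> (forall a, P (st a)) ->
  P 0 -> (forall x y, P x -> P y -> P (x + y)) ->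
  (forall (c : K) x, P x -> P (c *: x)) ->
  (forall x y, P x -> P y -> P (x * y)) ->
  forall x, P x.
Proof.
move=> Pp Ps Pst P0 PD PZ PM; elim/kp_ind; elim=> //.
- by move=> t Pt u Pu; rewrite -kpaddE; apply: PD.
- by move=> t Pt; rewrite -kpoppE -[kpopp _]/(- (_ : A)) -scaleN1r; apply: PZ.
- by move=> c t Pt; rewrite -kpscaleE; apply: PZ.
- by move=> t Pt u Pu; rewrite -kpmulE; apply: PM.
Qed.

Let fam := KP_familyP K rf.

Lemma uKP_s_idp v : s (idp L v) = p v. Proof. exact: fam_sv fam v. Qed.

Lemma uKP_ps v a : p v * s a = if v == rg a then s a else 0.
Proof.
rewrite -{1}(fam_kp2_ps fam a : p (rg a) * s a = s a) mulrA.
rewrite (fam_kp1 fam v (rg a) : p v * p (rg a) = _).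
case: eqP => [->|_]; first exact: fam_kp2_ps fam a.
exact: mul0r.
Qed.

Lemma uKP_ss a b : s a * s b = if src a == rg b then s (kcomp L a b) else 0.
Proof.
case: eqP => [ab|/eqP ab]; first exact: fam_kp2_s fam a b ab.
rewrite -(fam_kp2_sp fam a : s a * p (src a) = s a) -mulrA uKP_ps.
by rewrite (negbTE ab) mulr0.
Qed.

Lemma uKP_sts a b : deg a = deg b ->
  st a * s b = if a == b then p (src a) else 0.
Proof. exact: fam_kp3 fam a b. Qed.

Lemma uKP_kp4 v (n : 'rV[nat]_k) : n != 0 ->
  p v = \sum_(a \in [set: vpath v n]) s (val a) * st (val a).
Proof. by move=> n0; apply: fam_kp4 fam v n n0. Qed.

Lemma uKP_one (e : seq (vtx L)) : uniq e -> (forall v, v \in e) ->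
  1 = \sum_(v <- e) p v.
Proof. by move=> ue ee; rewrite -(fsbig_enum _ ue ee). Qed.

(** By (KP4), 1 is the sum of all s_b s_{b*} with b of degree n. *)
Lemma uKP_eq0 (n : 'rV[nat]_k) x :
  (forall b, deg b = n -> x * s b = 0) -> x = 0.
Proof.
move=> xs; have [e [ue ee]] := finite_enum fin.
rewrite -[x]mulr1 (uKP_one ue ee) big_distrr /= big1 // => v _.
have [n0|n0] := eqVneq n 0.
  by rewrite -uKP_s_idp xs // n0 deg_idp.
have [e' [ue' ee']] := finite_enum (rf v n).
rewrite (uKP_kp4 v n0) (fsbig_enum _ ue' ee') big_distrr /= big1 // => a _.
by rewrite mulrA xs ?mul0r //; have /andP[_ /eqP] := valP a.
Qed.

Definition span_src v x := exists2 g : {malg K[mor L]},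
  (forall a, a \in msupp g -> src a = v) & x = mlin s g.

Lemma span_src0 v : span_src v 0.
Proof. by exists 0; rewrite ?mlin0 // => a; rewrite msupp0. Qed.

Lemma span_srcD v x y : span_src v x -> span_src v y -> span_src v (x + y).
Proof.
move=> [g gs ->] [h hs ->]; exists (g + h); rewrite ?mlinD // => a.
by move=> /(fsubsetP (msuppD_le g h)); rewrite inE => /orP[/gs|/hs].
Qed.

Lemma span_srcZ v (c : K) x : span_src v x -> span_src v (c *: x).
Proof.
move=> [g gs ->]; exists (c *: g); rewrite ?mlinZ // => a.
by move=> /(fsubsetP (msuppZ_le c g)) /gs.
Qed.

Lemma span_src_s a : span_src (src a) (s a).
Proof.
exists << a >>; rewrite ?mlinU // => b.
by move=> /(fsubsetP msuppU_le); rewrite inE => /eqP ->.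
Qed.

Lemma span_src_if v a (P : bool) : src a = v ->
  span_src v (if P then s a else 0).
Proof. by move=> <-; case: P; [apply: span_src_s|apply: span_src0]. Qed.

(** Right multiplication by s_b absorbs ghost edges once b is long: if c is no
    longer than b, then s_{c*} s_b is zero or the s of the rest of b. So for
    long b the product x s_b involves no ghost edge at all. Together with
    [uKP_eq0], this plays the role of the usual spanning by the elements s_a
    s_{b*}. *)
Lemma uKP_span x : exists n, forall b m, deg b = n + m ->
  span_src (src b) (x * s b).
Proof.
elim/uKP_ind: x.
- by move=> v; exists 0 => b m _; rewrite uKP_ps; apply: span_src_if.
- move=> a; exists 0 => b m _; rewrite uKP_ss; case: eqP => [ab|_].
    by rewrite -(src_comp ab); apply: span_src_s.
  exact: span_src0.
- move=> a; exists (deg a) => b m /fac_ex [c [d [cd -> dc _]]].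
  have -> : s (kcomp L c d) = s c * s d by rewrite uKP_ss cd eqxx.
  rewrite mulrA uKP_sts //; rewrite src_comp //.
  case: eqP => [_|_]; last by rewrite mul0r; apply: span_src0.
  by rewrite uKP_ps; apply: span_src_if.
- by exists 0 => b m _; rewrite mul0r; apply: span_src0.
- move=> x y [n xn] [n' yn]; exists (n + n') => b m e; rewrite mulrDl.
  apply: span_srcD; first by apply: (xn _ (n' + m)); rewrite addrA.
  by apply: (yn _ (n + m)); rewrite addrA [n' + n]addrC.
- move=> c x [n xn]; exists n => b m e; rewrite -uKP_scaleAl.
  by apply: span_srcZ; apply: xn e.
(* y turns the first part of b, of degree n', into morphisms with the same
   source; the rest of b is still long enough for x. *)
move=> x y [n xn] [n' yn]; exists (n' + n) => b m.
rewrite -addrA => /fac_ex [c [d [cd -> dc dd]]].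
have -> : s (kcomp L c d) = s c * s d by rewrite uKP_ss cd eqxx.
have [|g gs yc] := yn c 0; first by rewrite addr0.
rewrite src_comp // -mulrA (mulrA y) yc /mlin big_distrl big_distrr /=.
rewrite big_seq; apply: (big_ind (span_src (src d))).
- exact: span_src0.
- by move=> u u'; apply: span_srcD.
move=> a /gs ac; rewrite -uKP_scaleAl -uKP_scaleAr uKP_ss ac cd eqxx.
have ad : src a = rg d by rewrite ac.
apply: span_srcZ; rewrite -(src_comp ad); apply: (xn _ (deg a + m)).
by rewrite deg_comp // dd addrCA.
Qed.

End KPAlgebra.

(** * The path representation of the pullback *)

Section WeightedComposition.
Variables (K : comPzRingType) (Q : Type).
Local Notation W := (Q -> K^o).
Implicit Types (c : Q -> Prop) (g : Q -> Q) (phi : W).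

Fact wco_subproof c g :
  (fun phi q => if `[< c q >] then phi (g q) else 0) \in @linear_fun K W.
Proof.
rewrite inE => d u v; apply/funext => q.
have e u' v' : (d *: u' + v' : W) q = d * u' q + v' q by [].
by rewrite !e; case: asbool => //; rewrite mulr0 addr0.
Qed.

Definition wco c g : linop W := LinOp (wco_subproof c g).

Lemma wcoE c g phi q : wco c g phi q = if `[< c q >] then phi (g q) else 0.
Proof. by []. Qed.

Lemma wco_comp c g c' g' : linop_comp (wco c g) (wco c' g') =
  wco (fun q => c q /\ c' (g q)) (g' \o g).
Proof.
apply/linopP => phi; apply/funext => q; rewrite linop_compE !wcoE asbool_and /=.
by case: asboolP.
Qed.

Lemma wco_eq c g c' g' : (forall q, c q <-> c' q) ->
  (forall q, c q -> g q = g' q) -> wco c g = wco c' g'.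
Proof.
move=> cc gg; apply/linopP => phi; apply/funext => q; rewrite !wcoE.
by rewrite -(asbool_equiv_eq (cc q)); case: asboolP => // /gg ->.
Qed.

Lemma wco_eq0 c g : (forall q, ~ c q) -> wco c g = 0.
Proof.
move=> cF; apply/linopP => phi; rewrite linop_0E; apply/funext => q.
by rewrite wcoE; case: asboolP => // /cF.
Qed.

Lemma linop_sumE (T : Type) (r : seq T) (F : T -> linop W) phi q :
  (\sum_(t <- r) F t) phi q = \sum_(t <- r) F t phi q.
Proof.
by apply: (big_morph (fun T : linop W => T phi q)) => [S T'|];
  rewrite ?linop_addE ?linop_0E.
Qed.

(** (KP4), the unit and the elements U_h are all sums over a partition of a
    set of paths, by origin or by initial segment. *)
Lemma sum_wco (T : eqType) (e : seq T) (c : T -> Q -> Prop) (c0 : Q -> Prop) g :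
  uniq e -> (forall t, t \in e) -> (forall t q, c t q -> c0 q) ->
  (forall q, c0 q -> exists! t, c t q) ->
  \sum_(t <- e) wco (c t) g = wco c0 g.
Proof.
move=> ue ee cc0 c0c; apply/linopP => phi; apply/funext => q.
rewrite linop_sumE wcoE; case: asboolP => [/c0c [t [ct tu]]|nc].
  rewrite (bigD1_seq t) //= big1 ?addr0; first by rewrite ifT //; apply/asboolP.
  by move=> t' /eqP tt'; case: asboolP => // /tu /esym.
by rewrite big1 // => t _; rewrite wcoE; case: asboolP => // /cc0.
Qed.

Definition delta (q : Q) : W := fun q' => if `[< q' = q >] then 1 else 0.

Lemma delta_eq q q' (b : Prop) : (q' = q <-> b) ->
  delta q q' = if `[< b >] then 1 else 0.
Proof. by move=> e; rewrite /delta (asbool_equiv_eq e). Qed.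

End WeightedComposition.

Lemma toZ0 m : toZ (0 : 'rV[nat]_m) = 0.
Proof. by apply/rowP => i; rewrite !mxE. Qed.

Section Representation.
Variables (K : comPzRingType) (k l : nat).
Variables (f : {additive 'rV[nat]_k -> 'rV[nat]_l}) (G : kgraph l).
Hypothesis rfG : row_finite G.
Local Notation L := (pullback f G).
Local Notation pt := (rawpath G * 'rV[int]_k)%type.
Local Notation W := (pt -> K^o).
Implicit Types (a b : mor L) (q : pt).

Definition gmor a : mor G := (val a).1.

Lemma deg_gmor a : deg (gmor a) = f (deg a).
Proof. exact: eqP (valP a). Qed.

Lemma gmor_comp a b : src a = rg b ->
  gmor (kcomp L a b) = kcomp G (gmor a) (gmor b).
Proof. by move=> ab; rewrite /gmor pb_compE. Qed.

Lemma pbmor_eq a b : gmor a = gmor b -> deg a = deg b -> a = b.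
Proof.
move=> e1 e2; apply: val_inj.
by rewrite [val a]surjective_pairing [RHS]surjective_pairing; congr pair.
Qed.

Lemma pbmor_exists (m : mor G) (n : 'rV[nat]_k) : deg m = f n ->
  exists2 a, gmor a = m & deg a = n.
Proof. by move=> /eqP mn; exists (exist _ (m, n) mn). Qed.

Lemma pullback_row_finite : row_finite L.
Proof.
move=> v n; have -> : [set: @vpath k L v n] =
    (fun a : @vpath k L v n => gmor (val a)) @^-1`
      (val @` [set: @vpath l G v (f n)]).
  apply/seteqP; split=> // a _ /=.
  have aP : (rg (gmor (val a)) == v) && (deg (gmor (val a)) == f n).
    by case/andP: (valP a) => h /eqP h'; rewrite deg_gmor h' eqxx andbT.
  by exists (exist _ (gmor (val a)) aP).
apply: finite_preimage; last exact/finite_image/rfG.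
move=> a b _ _ e; apply: val_inj; apply: pbmor_eq => //.
by case/andP: (valP a) => _ /eqP ->; case/andP: (valP b) => _ /eqP ->.
Qed.

(** Operators on functions of a path x and a vector t of Z^k: s_(a, n)
    substitutes (shift of x, t - n) where x starts with a, and its ghost
    substitutes (a x, t + n) where x can be extended by a. On the indicator
    function of a point (y, t), s_(a, n) thus moves y to a y and t to t + n.
    The second coordinate records the degree in N^k, of which paths of the
    base graph only see the image under f. *)
Definition rep_p (v : vtx L) : linop W :=
  wco K (fun q => ipath q.1 /\ origin q.1 = v) id.

Definition rep_s a : linop W :=
  wco K (fun q => ipath q.1 /\ q.1 (deg (gmor a)) = gmor a)
    (fun q => (pshift (deg (gmor a)) q.1, q.2 - toZ (deg a))).

Definition rep_st a : linop W :=
  wco K (fun q => ipath q.1 /\ src (gmor a) = origin q.1)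
    (fun q => (pcons (gmor a) q.1, q.2 + toZ (deg a))).

Lemma rep_sst a b : gmor a = gmor b -> linop_comp (rep_s a) (rep_st b) =
  wco K (fun q => ipath q.1 /\ q.1 (deg (gmor a)) = gmor a)
    (fun q => (q.1, q.2 - (toZ (deg a) - toZ (deg b)))).
Proof.
move=> ab; rewrite wco_comp; apply: wco_eq => [[x t]|[x t]] /=.
  split=> [[]//|[xp xa]]; do 2 split=> //; first exact: ipath_pshift.
  by rewrite -ab origin_pshift // xa.
by move=> [[xp xa] _]; rewrite -ab -{1}xa pcons_pshift // opprD opprK addrA.
Qed.

Lemma rep_family : KP_family (@linop_comp K W) rep_p rep_s rep_st.
Proof.
split.
- move=> v; apply: wco_eq => [[x t]|[x t]] /=.
    split=> -[xp]; rewrite deg_idp ipath0 //; last by move->.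
    by move=> /(congr1 (@rg _ _)); rewrite !rg_idp.
  by move=> [xp _]; rewrite deg_idp pshift0 // toZ0 subr0.
- move=> v; apply: wco_eq => [[x t]|[x t]] /=.
    by rewrite src_idp; split=> -[xp ->].
  by rewrite src_idp => -[xp ->]; rewrite pcons_idp // toZ0 addr0.
- move=> v w; rewrite wco_comp; case: eqP => [->|vw].
    by apply: wco_eq => [q|q] //; split=> [[]|].
  by apply: wco_eq0 => q [[_ e] [_ e']]; apply: vw; rewrite -e.
- move=> a b ab; rewrite wco_comp; have ab' : src (gmor a) = rg (gmor b) by [].
  apply: wco_eq => [[x t]|[x t]] /=; rewrite gmor_comp // deg_comp //.
    split=> [[[xp xa] [_ xb]]|[xp /(ipath_comp xp ab')[xa xb]]].
      by split=> //; apply/ipath_comp.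
    by do 2 split=> //; apply: ipath_pshift.
  move=> [[xp _] _]; rewrite pshiftD //.
  by rewrite (@pb_deg_comp _ _ f G a b ab) toZD opprD addrA.
- move=> a b ab; rewrite wco_comp; have ab' : src (gmor a) = rg (gmor b) by [].
  apply: wco_eq => [[x t]|[x t]] /=; rewrite gmor_comp //.
    rewrite src_comp //; split=> [[[xp xb] _]//|[xp xb]].
    do 2 split=> //; first exact: ipath_pcons.
    by rewrite origin_pcons.
  move=> [[xp xb] _]; rewrite pcons_comp //.
  by rewrite (@pb_deg_comp _ _ f G a b ab) toZD [toZ _ + _]addrC addrA.
- move=> a; rewrite wco_comp; apply: wco_eq => [[x t]|//] /=.
  split=> [[]//|[xp xa]]; do 2 split=> //.
  by rewrite -(ipath_rg (deg (gmor a)) xp) xa.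
- move=> a; rewrite wco_comp; apply: wco_eq => [[x t]|//] /=.
  split=> [[]//|[xp xa]]; do 2 split=> //; first exact: ipath_pshift.
  by rewrite origin_pshift // xa.
- move=> a; rewrite wco_comp; apply: wco_eq => [[x t]|//] /=.
  by split=> [[]//|[xp xa]]; do 2 split.
- move=> a; rewrite wco_comp; apply: wco_eq => [[x t]|//] /=.
  split=> [[]//|[xp xa]]; do 2 split=> //; first exact: ipath_pcons.
  by rewrite origin_pcons.
- move=> a b ab; rewrite wco_comp.
  have dab : deg (gmor a) = deg (gmor b) by rewrite !deg_gmor ab.
  case: eqP => [<-|ne].
    apply: wco_eq => [[x t]|[x t]] /=.
      split=> [[[]]//|[xp xa]]; do 2 split=> //; first exact: ipath_pcons.
      by rewrite pcons_deg.
    by move=> [[xp xa] _]; rewrite pshift_pcons // addrK.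
  apply: wco_eq0 => -[x t] /= [[xp xa] [_]].
  by rewrite -dab pcons_deg // => gab; apply: ne; apply: pbmor_eq.
move=> v n _; have [e [ue ee]] := finite_enum (@pullback_row_finite v n).
rewrite (fsbig_enum _ ue ee).
have vP (a : @vpath k L v n) : rg (gmor (val a)) = v /\ deg (val a) = n.
  by case/andP: (valP a) => /eqP ? /eqP.
under eq_bigr do rewrite rep_sst // subrr.
have -> : rep_p v = wco K (fun q => ipath q.1 /\ origin q.1 = v)
    (fun q => (q.1, q.2 - 0)).
  by apply: wco_eq => // -[x t] _ /=; rewrite subr0.
apply/esym; apply: sum_wco => // [a [x t]|[x t]] /= [xp xv].
  by split=> //; rewrite -(vP a).1 -xv ipath_rg.
have xn : deg (x (f n)) = f n by rewrite ipath_deg.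
have [a ga da] := pbmor_exists xn.
have aP : (rg a == v) && (deg a == n).
  by rewrite da eqxx andbT -xv -(ipath_rg (f n) xp) -ga eqxx.
exists (exist _ a aP); split; first by split=> //=; rewrite ga xn.
move=> b [_ xb]; apply: val_inj.
apply: pbmor_eq; last by rewrite [LHS]da (vP b).2.
by rewrite [LHS] ga -xb deg_gmor (vP b).2.
Qed.

End Representation.

(** * Faithfulness *)

Section FaithfulRepresentation.
Variables (K : comNzRingType) (k l : nat).
Variables (f : {additive 'rV[nat]_k -> 'rV[nat]_l}) (G : kgraph l).
Hypotheses (rfG : row_finite G) (nsG : no_sources G).
Variable fin : finite_set [set: vtx G].
Local Notation L := (pullback f G).
Local Notation pt := (rawpath G * 'rV[int]_k)%type.
Local Notation W := (pt -> K^o).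
Local Notation A := (@uKP K k L fin).
Implicit Types (a b : mor L) (q : pt) (u w : A).

Lemma rep_exists : exists pi : A -> linop W,
  [/\ linear pi, {morph pi : u w / u * w >-> linop_comp u w} &
      [/\ forall v, pi (kp_p v) = rep_p K v,
          forall a, pi (kp_s a) = rep_s K a &
          forall a, pi (kp_st a) = rep_st K a]].
Proof.
have [pi [h _]] := KP_universal (@linop_compA K W) (@linop_compDl K W)
  (@linop_compDr K W) (@linop_compZl K W) (@linop_compZr K W)
  (rep_family K f rfG).
by exists pi.
Qed.

Definition rep : A -> linop W := sval (cid rep_exists).

Let repP := svalP (cid rep_exists).

Lemma rep_linear : linear rep. Proof. by have [] := repP. Qed.

Lemma repM u w : rep (u * w) = linop_comp (rep u) (rep w).
Proof. by have [_ h _] := repP; apply: h. Qed.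

Lemma rep_pE v : rep (kp_p v) = rep_p K v.
Proof. by have [_ _ [h _ _]] := repP; apply: h. Qed.

Lemma rep_sE a : rep (kp_s a) = rep_s K a.
Proof. by have [_ _ [_ h _]] := repP; apply: h. Qed.

Lemma rep_stE a : rep (kp_st a) = rep_st K a.
Proof. by have [_ _ [_ _ h]] := repP; apply: h. Qed.

Lemma repD u w : rep (u + w) = rep u + rep w.
Proof. by have := rep_linear 1 u w; rewrite !scale1r. Qed.

Lemma rep0 : rep 0 = 0.
Proof. by apply: (addrI (rep 0)); rewrite -repD !addr0. Qed.

Lemma repZ c u : rep (c *: u) = c *: rep u.
Proof. by have := rep_linear c u 0; rewrite rep0 !addr0. Qed.

Lemma rep_sum (T : Type) (r : seq T) (F : T -> A) :
  rep (\sum_(t <- r) F t) = \sum_(t <- r) rep (F t).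
Proof. exact: (big_morph rep repD rep0). Qed.

Lemma rep1 : rep 1 = wco K (fun q => ipath q.1) id.
Proof.
have [e [ue ee]] := finite_enum fin.
rewrite (@uKP_one K k L fin e ue ee) rep_sum; under eq_bigr do rewrite rep_pE.
apply: sum_wco => //= [v q []//|q qp].
by exists (origin q.1); split=> [|v []].
Qed.

Lemma rep_s_delta a (y : rawpath G) t : ipath y -> src a = origin y ->
  rep_s K a (delta K (y, t)) = delta K (pcons (gmor a) y, t + toZ (deg a)).
Proof.
move=> yp ay; apply/funext => -[x t']; rewrite /rep_s wcoE /delta /=.
have ay' : src (gmor a) = origin y by [].
case: asboolP => [[xp xa]|nxa]; last first.
  case: asboolP => // -[e _]; case: nxa; rewrite e; split.
    exact: ipath_pcons.
  exact: pcons_deg.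
congr (if _ then _ else _); apply: asbool_equiv_eq; split=> -[].
  move=> e <-; rewrite subrK; congr pair; exact: pcons_uniq.
by move=> -> ->; rewrite pshift_pcons // addrK.
Qed.

Lemma rep_mlin_delta (g : {malg K[mor L]}) (y : rawpath G) t q : ipath y ->
  (forall a, a \in msupp g -> src a = origin y) ->
  rep (mlin (kp_s : mor L -> A) g) (delta K (y, t)) q =
  \sum_(a <- msupp g)
    g@_a * delta K (pcons (gmor a) y, t + toZ (deg a)) q.
Proof.
move=> yp gs; rewrite /mlin rep_sum linop_sumE big_seq [RHS]big_seq.
by apply: eq_bigr => a /gs ay; rewrite repZ linop_scaleE rep_sE rep_s_delta.
Qed.

Lemma pcons_gmor_inj a b (y : rawpath G) : ipath y -> src a = origin y ->
  src b = origin y -> deg a = deg b ->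
  pcons (gmor a) y = pcons (gmor b) y -> a = b.
Proof.
move=> yp ay bo ab e; apply: pbmor_eq => //.
have dg : deg (gmor a) = deg (gmor b) by rewrite !deg_gmor ab.
rewrite -(pcons_deg yp (ay : src (gmor a) = _)) e dg.
exact: (pcons_deg yp (bo : src (gmor b) = _)).
Qed.

(** Two morphisms of the pullback of the same degree in N^k have base
    morphisms of the same degree, so they extend y to different paths;
    morphisms of different degrees are told apart by the second coordinate. *)
Lemma rep_mlin_coef (g : {malg K[mor L]}) (y : rawpath G) t a : ipath y ->
  (forall a, a \in msupp g -> src a = origin y) -> a \in msupp g ->
  rep (mlin (kp_s : mor L -> A) g) (delta K (y, t))
    (pcons (gmor a) y, t + toZ (deg a)) = g@_a.
Proof.
move=> yp gs ag; rewrite rep_mlin_delta // (bigD1_seq a) ?fset_uniq //=.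
rewrite big_seq_cond big1 ?addr0 => [|b /andP[bg /eqP ba]].
  by rewrite /delta asboolT // mulr1.
rewrite /delta asboolF ?mulr0 // => -[e /addrI /toZ_inj d].
by apply: ba; apply: (pcons_gmor_inj yp); rewrite ?gs // e.
Qed.

(** Long s_b turn u into a combination of the s_a, whose coefficients
    [rep_mlin_coef] reads off from the action on indicator functions. *)
Lemma rep_inj_delta u :
  (forall (y : rawpath G) t, ipath y -> rep u (delta K (y, t)) = 0) -> u = 0.
Proof.
move=> u0; have rfL := @pullback_row_finite _ _ f _ rfG.
have [n un] := uKP_span rfL u.
apply: (@uKP_eq0 _ _ _ rfL _ n) => b db.
have [|g gs ub] := un b 0; first by rewrite addr0.
rewrite ub; suff -> : g = 0 by rewrite mlin0.
have [y yp yb] := ipath_exists nsG (src b).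
apply/malgP => a; rewrite mcoeff0.
have [ag|/mcoeff_outdom//] := boolP (a \in msupp g).
rewrite -(@rep_mlin_coef g y 0 a) //; last by move=> c /gs ->.
rewrite -ub repM linop_compE rep_sE rep_s_delta // u0 //.
exact: ipath_pcons.
Qed.

Definition translation (h : 'rV[int]_k) : linop W :=
  wco K (fun=> True) (fun q => (q.1, q.2 - h)).

Lemma translation_wco h c g : linop_comp (translation h) (wco K c g) =
  wco K (fun q => c (q.1, q.2 - h)) (fun q => g (q.1, q.2 - h)).
Proof. by rewrite wco_comp; apply: wco_eq => q //=; split=> [[]|]. Qed.

Lemma wco_translation h c g : linop_comp (wco K c g) (translation h) =
  wco K c (fun q => ((g q).1, (g q).2 - h)).
Proof. by rewrite wco_comp; apply: wco_eq => q //=; split=> [[]|]. Qed.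

(** Generators change the second coordinate by constants only. *)
Lemma translation_rep h u :
  linop_comp (translation h) (rep u) = linop_comp (rep u) (translation h).
Proof.
elim/uKP_ind: u => [v|a|a||u v IHu IHv|c u IHu|u v IHu IHv].
- by rewrite rep_pE translation_wco wco_translation.
- rewrite rep_sE translation_wco wco_translation; apply: wco_eq => //= q _.
  by rewrite addrAC.
- rewrite rep_stE translation_wco wco_translation; apply: wco_eq => //= q _.
  by rewrite addrAC.
- rewrite rep0; apply/linopP => phi.
  by rewrite !linop_compE !linop_0E linop0.
- by rewrite repD linop_compDl linop_compDr IHu IHv.
- by rewrite repZ -linop_compZl -linop_compZr IHu.
- by rewrite repM linop_compA IHu -linop_compA IHv linop_compA.
Qed.

Lemma translation_delta h q :
  translation h (delta K q) = delta K (q.1, q.2 + h).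
Proof.
case: q => y t; apply/funext => -[x t']; rewrite wcoE asboolT // /delta /=.
congr (if _ then _ else _); apply: asbool_equiv_eq; split=> -[-> e].
  by rewrite -e subrK.
by rewrite e addrK.
Qed.

Lemma translationD h h' :
  linop_comp (translation h) (translation h') = translation (h + h').
Proof.
rewrite translation_wco; apply: wco_eq => //= q _.
by rewrite opprD addrA.
Qed.

End FaithfulRepresentation.

Section CentralUnits.
Variables (K : fieldType) (k l : nat).
Variables (f : {additive 'rV[nat]_k -> 'rV[nat]_l}) (G : kgraph l).
Hypotheses (rfG : row_finite G) (nsG : no_sources G).
Variable fin : finite_set [set: vtx G].
Local Notation A := (KPpb K f fin).
Local Notation rep := (rep (K := K) (f := f) rfG (fin := fin)).
Local Notation U := (Uelt (f := f) K fin).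
Implicit Types (h : kergrp f) (u w : A).

(** Each summand of U_h removes an initial segment from the path and puts it
    back, and changes the second coordinate by h_+ - h_- = h. The factor [rep
    1] is the projection onto functions supported on genuine paths. *)
Lemma rep_Uelt h : rep (U h) =
  linop_comp (translation K G (kval h)) (rep 1).
Proof.
rewrite rep1 translation_wco /Uelt; set n := f (posp (kval h)).
have [e [ue ee]] := finite_enum fin.
rewrite (fsbig_enum _ ue ee) rep_sum.
rewrite -(sum_wco K (c := fun v q => ipath q.1 /\ origin q.1 = v) _ ue ee);
  first last.
- by move=> q qp; exists (origin q.1); split=> [|v []].
- by move=> v q [].
apply: eq_bigr => v _.
have [e' [ue' ee']] := finite_enum (rfG v n).
rewrite (fsbig_enum _ ue' ee') rep_sum.
rewrite -(sum_wco K (c := fun a q => ipath q.1 /\ q.1 n = val a) _ ue' ee').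
- apply: eq_bigr => a _; rewrite repM rep_sE rep_stE rep_sst //.
  rewrite deg_gmor; apply: wco_eq => // q _.
  by rewrite [in RHS](posnegE (kval h)).
- move=> a q [qp qa]; split=> //.
  by rewrite -(ipath_rg n qp) qa; have /andP[/eqP] := valP a.
move=> [x t] /= [xp xv].
have aP : (rg (x n) == v) && (deg (x n) == f (posp (kval h))).
  by rewrite ipath_rg // xv ipath_deg // !eqxx.
exists (exist _ (x n) aP); split=> // b [_ e'']; exact: val_inj.
Qed.

End CentralUnits.

(** * The central embedding of the group algebra *)

Section GroupAlgebraEmbedding.
Variables (K : fieldType) (k l : nat).
Variables (f : {additive 'rV[nat]_k -> 'rV[nat]_l}) (G : kgraph l).
Hypotheses (rfG : row_finite G) (nsG : no_sources G).
Variable fin : finite_set [set: vtx G].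
Local Notation A := (KPpb K f fin).
Local Notation rep := (rep (K := K) (f := f) rfG (fin := fin)).
Local Notation U := (Uelt (f := f) K fin).
Local Notation iota := (@kp_iota K k l f G fin).
Implicit Types (h : kergrp f) (u w : A).

Lemma rep_ext u w :
  (forall (y : rawpath G) t, ipath y ->
    rep u (delta K (y, t)) = rep w (delta K (y, t))) -> u = w.
Proof.
move=> e; apply/eqP; rewrite -subr_eq0; apply/eqP.
apply: (@rep_inj_delta _ _ _ _ _ rfG nsG) => y t yp.
by rewrite -scaleN1r repD repZ linop_addE linop_scaleE e // scaleN1r subrr.
Qed.

Lemma rep_inj : injective rep.
Proof. by move=> u w e; apply: rep_ext => y t _; rewrite e. Qed.

Lemma UeltD h h' : U h * U h' = U (h + h').
Proof.
apply: rep_inj.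
rewrite repM (rep_Uelt K rfG fin h) (rep_Uelt K rfG fin h').
rewrite (rep_Uelt K rfG fin (h + h')) linop_compA.
rewrite -(linop_compA (translation _ _ _)) -translation_rep linop_compA.
by rewrite translationD -linop_compA -repM mulr1.
Qed.

Lemma Uelt0 : U 0 = 1.
Proof.
apply: rep_inj; rewrite rep_Uelt rep1 translation_wco.
by apply: wco_eq => [q|[x t] _] //=; rewrite subr0.
Qed.

Lemma Uelt_central h u : U h * u = u * U h.
Proof.
apply: rep_inj; rewrite !repM rep_Uelt -linop_compA -repM mul1r.
by rewrite translation_rep -{1}[u]mulr1 repM -!linop_compA translation_rep.
Qed.

Lemma iota_mlin x : iota x = mlin U x. Proof. by []. Qed.

Lemma iota_linear : linear iota. Proof. exact: mlin_linear. Qed.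

Lemma iota_gbasis h : iota (gbasis K h) = U h. Proof. exact: mlinU. Qed.

Lemma iotaU (c : K) h : iota << c *g h >> = c *: U h.
Proof. by rewrite iota_mlin (mlinw _ msuppU_le) big_seq_fset1 mcoeffUU. Qed.

Lemma iotaD x y : iota (x + y) = iota x + iota y. Proof. exact: mlinD. Qed.

Lemma iotaZ c x : iota (c *: x) = c *: iota x. Proof. exact: mlinZ. Qed.

Lemma iota0 : iota 0 = 0. Proof. exact: mlin0. Qed.

Lemma iota_monoid_morphism : monoid_morphism iota.
Proof.
split=> [|x y]; first by rewrite -Uelt0 -iota_gbasis.
elim/grpalg_ind: x => [|x x' IH IH'|c g].
- by rewrite mul0r iota0 mul0r.
- rewrite (mulrDl x x' y) !iotaD (mulrDl (iota x)).
  exact: congr2 IH IH'.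
elim/grpalg_ind: y => [|y y' IH IH'|c' g'].
- by rewrite mulr0 iota0 mulr0.
- rewrite (mulrDr _ y y') !iotaD (mulrDr _ (iota y)).
  exact: congr2 IH IH'.
have -> : (<< c *g g >> : grpalg K (kergrp f)) * << c' *g g' >> =
    << c * c' *g (g + g') >> by exact: gamulUU.
have cUU : (c * c') *: U (g + g') = (c *: U g) * (c' *: U g').
  by rewrite -(UeltD g g') -scalerA (uKP_scaleAr c') -(uKP_scaleAl c).
apply: (etrans (iotaU (c * c') (g + g'))); apply: (etrans cUU).
by apply/esym; apply: congr2; apply: iotaU.
Qed.

Lemma iota_central x : center A (iota x).
Proof.
move=> u; elim/grpalg_ind: x => [|x x' IH IH'|c g].
- by rewrite iota0 mul0r mulr0.
- rewrite iotaD (mulrDl (iota x)) (mulrDr u).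
  exact: congr2 IH IH'.
rewrite iotaU -uKP_scaleAl -uKP_scaleAr.
by rewrite Uelt_central.
Qed.

Lemma rep_Uelt_delta h (y : rawpath G) t : ipath y ->
  rep (U h) (delta K (y, t)) = delta K (y, t + kval h).
Proof.
move=> yp; have e : rep 1 (delta K (y, t)) = delta K (y, t).
  rewrite rep1; apply/funext => q; rewrite wcoE; case: asboolP => // nq.
  by rewrite /delta asboolF // => qE; apply: nq; rewrite qE.
by rewrite rep_Uelt linop_compE e translation_delta.
Qed.

(** The translates of one indicator function are independent, which makes iota
    injective as soon as there is a path. *)
Lemma rep_iota_coef x h (y : rawpath G) : ipath y ->
  rep (iota x) (delta K (y, 0)) (y, kval h) = x@_h.
Proof.
move=> yp; elim/grpalg_ind: x => [|x x' IH IH'|c g].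
- by rewrite iota0 rep0 linop_0E mcoeff0.
- by rewrite iotaD repD linop_addE mcoeffD -IH -IH'.
rewrite iotaU repZ linop_scaleE rep_Uelt_delta // mcoeffU.
rewrite add0r -mulr_natr.
congr (_ * _); rewrite (@delta_eq _ _ _ _ (g = h)).
  by case: asboolP => [->|/eqP/negbTE ->]; rewrite ?eqxx.
by split=> [[/val_inj ->]|->].
Qed.

Lemma iota_inj (v : vtx G) : injective iota.
Proof.
move=> x x' e; have [y yp _] := ipath_exists nsG v.
by apply/malgP => h; rewrite -!(rep_iota_coef _ _ yp) e.
Qed.

End GroupAlgebraEmbedding.

(** * The center *)

Section Center.
Variables (K : fieldType) (k l : nat).
Variables (f : {additive 'rV[nat]_k -> 'rV[nat]_l}) (G : kgraph l).
Hypothesis f_surj : forall m : 'rV[nat]_l, exists n : 'rV[nat]_k, f n = m.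
Hypotheses (rfG : row_finite G) (nsG : no_sources G).
Hypotheses (cofG : cofinal G) (apG : aperiodic G).
Variable fin : finite_set [set: vtx G].
Local Notation L := (pullback f G).
Local Notation A := (KPpb K f fin).
Local Notation rep := (rep (K := K) (f := f) rfG (fin := fin)).
Local Notation U := (Uelt (f := f) K fin).
Local Notation iota := (@kp_iota K k l f G fin).
Variable z : A.
Hypothesis zC : center A z.
Implicit Types (x y : rawpath G) (a b : mor L).

Lemma gmor_surj (m : mor G) : exists a, gmor a = m.
Proof.
have [n fn] := f_surj (deg m).
by have [a am _] := pbmor_exists (esym fn); exists a.
Qed.

(** z commutes with s_a s_{a*}, which multiplies a function by the indicator
    of the paths that start with a. Hence z cannot move y to a path with a
    different initial segment. *)
Lemma central_diag y t x t' : ipath y ->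
  rep z (delta K (y, t)) (x, t') != 0 -> x = y.
Proof.
move=> yp nz; apply/funext => n; apply: contrapT => xyn.
move/eqP: nz; apply.
have [a an] := gmor_surj (y n).
(* s_a s_{a*} fixes the indicator of (y, t) and kills functions at (x, t'). *)
have rE : rep ((kp_s a : A) * kp_st a) =
    wco K (fun q => ipath q.1 /\ q.1 n = y n) (fun q => (q.1, q.2 - 0)).
  rewrite repM rep_sE rep_stE rep_sst // an ipath_deg //.
  by apply: wco_eq => // q _; rewrite subrr.
have -> : delta K (y, t) = rep ((kp_s a : A) * kp_st a) (delta K (y, t)).
  rewrite rE; apply/funext => -[x' t'']; rewrite wcoE /= subr0.
  case: asboolP => // nq; rewrite /delta asboolF // => -[xy _].
  by apply: nq; rewrite xy.
rewrite -linop_compE -repM zC repM linop_compE rE wcoE asboolF //.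
by case.
Qed.

(** By [central_diag] and invariance under translation, these numbers
    determine the action of z on indicator functions. *)
Definition coef y (t : 'rV[int]_k) : K := rep z (delta K (y, 0)) (y, t).

Lemma coefE y t t' : coef y t' = rep z (delta K (y, t)) (y, t + t').
Proof.
have -> : delta K (y, t) = translation K G t (delta K (y, 0)).
  by rewrite translation_delta /= add0r.
rewrite -linop_compE -translation_rep linop_compE wcoE asboolT //=.
by rewrite [t + t']addrC addrK.
Qed.

(** z commutes with s_a, so its coefficients are constant along tail
    equivalence classes of paths. *)
Lemma coef_pcons (m : mor G) y t : ipath y -> src m = origin y ->
  coef (pcons m y) t = coef y t.
Proof.
move=> yp my; have [a am] := gmor_surj m; subst m.
rewrite (coefE _ (0 + toZ (deg a))) -rep_s_delta // -(rep_sE K rfG fin).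
rewrite -linop_compE -repM zC repM linop_compE rep_sE wcoE asboolT /=.
  by rewrite pshift_pcons // add0r [_ + t]addrC addrK.
by split; [apply: ipath_pcons|apply: pcons_deg].
Qed.

(** z s_b sends y to a combination of the paths a y, with a in the support,
    while z keeps the path b y fixed up to coefficients; so a y = b y. *)
Lemma span_pcons b g :
  (forall a, a \in msupp g -> src a = src b) ->
  z * kp_s b = mlin (kp_s : mor L -> A) g ->
  forall a y, a \in msupp g -> ipath y -> src b = origin y ->
    pcons (gmor a) y = pcons (gmor b) y.
Proof.
move=> gs zb a y ag yp bo.
apply: (central_diag (t := 0 + toZ (deg b)) (t' := 0 + toZ (deg a))).
  exact: ipath_pcons.
rewrite -rep_s_delta // -(rep_sE K rfG fin) -linop_compE -repM zb.
rewrite rep_mlin_coef // ?mcoeff_neq0 // => c cg.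
by rewrite gs.
Qed.

(** If m y = m' y and y is aperiodic, then removing from both sides an initial
    segment of degree d(m) + d(m') leaves shifts of y by d(m') and by d(m), so
    that d(m) = d(m'). *)
Lemma aperiodic_eq (m m' : mor G) : src m = src m' ->
  (forall y, ipath y -> src m = origin y -> pcons m y = pcons m' y) -> m = m'.
Proof.
move=> mm e; have [y [yp ym yap]] := aperiodic_ipath apG (src m).
have my : src m = origin y by [].
have m'y : src m' = origin y by rewrite -mm.
have em := e y yp my.
have mp := ipath_pcons yp my; have m'p := ipath_pcons yp m'y.
have dE : deg m' = deg m.
  apply: yap; rewrite -{1}(pshift_pcons yp my) pshiftD // em addrC.
  by rewrite -pshiftD // pshift_pcons.
by rewrite -(pcons_deg yp my) em -dE pcons_deg.
Qed.

(** Local constancy: the right-hand side does not depend on y. *)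
Lemma coef_span b g :
  (forall a, a \in msupp g -> src a = src b) ->
  z * kp_s b = mlin (kp_s : mor L -> A) g ->
  forall y t, ipath y -> src b = origin y -> coef (pcons (gmor b) y) t =
    \sum_(a <- msupp g) if toZ (deg a) == toZ (deg b) + t then g@_a else 0.
Proof.
move=> gs zb y t yp bo; rewrite (coefE _ (0 + toZ (deg b))) -rep_s_delta //.
rewrite -(rep_sE K rfG fin) -linop_compE -repM zb rep_mlin_delta //; last first.
  by move=> a ag; rewrite gs.
rewrite big_seq [RHS]big_seq; apply: eq_bigr => a ag.
rewrite (span_pcons gs zb ag yp bo) !add0r.
rewrite (@delta_eq _ _ _ _ (toZ (deg a) = toZ (deg b) + t)).
  by case: asboolP => [->|/eqP/negbTE ->]; rewrite ?eqxx ?mulr1 ?mulr0.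
by split=> [[->]|->].
Qed.

Lemma central_span : exists n, forall m : mor G, deg m = f n ->
  exists b, exists2 g : {malg K[mor L]},
    [/\ gmor b = m, deg b = n & forall a, a \in msupp g -> src a = src b] &
    z * kp_s b = mlin (kp_s : mor L -> A) g.
Proof.
have [n zn] := uKP_span (@pullback_row_finite _ _ f _ rfG) (z : uKP K _).
exists n => m mn; have [b bm bn] := pbmor_exists mn.
have [|g gs zb] := zn b 0; first by rewrite addr0.
by exists b, g.
Qed.

(** By cofinality some tail of y can be prefixed by a morphism to give a path
    that starts with the initial segment of y' on which the coefficients
    depend. The coefficient at that path is the one at y by invariance, and
    the one at y' by local constancy. *)
Lemma coef_const y y' t : ipath y -> ipath y' -> coef y t = coef y' t.
Proof.
move=> yp yp'; have [n zn] := central_span.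
have [b [g [bm bn gs] zb]] := zn (y' (f n)) (ipath_deg yp' _).
have [p [m [rm sm]]] := cofinal_ipath cofG (src (y' (f n))) yp.
have pp := ipath_pshift p yp; have mp := ipath_pcons pp sm.
have srcb : src b = src (y' (f n)) by rewrite -bm.
have o1 : src (y p) = origin (pshift p y) by rewrite origin_pshift.
have o2 : src b = origin (pcons m (pshift p y)) by rewrite origin_pcons // rm.
have o3 : src b = origin (pshift (f n) y') by rewrite origin_pshift.
rewrite -{1}(pcons_pshift p yp) coef_pcons // -(coef_pcons t pp sm).
rewrite -(coef_pcons (m := gmor b) t mp o2) (coef_span gs zb) //.
rewrite -(coef_span gs zb t (ipath_pshift (f n) yp') o3).
by rewrite bm pcons_pshift.
Qed.

(** The coefficients of z at any one path y0, computed by [coef_span] on a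
    long initial segment b of y0, are those of z everywhere. Each a in the
    support has the same base morphism as b, so the difference of their
    degrees lies in H. *)
Lemma center_iota (v0 : vtx G) : range iota z.
Proof.
have [y0 yp0 _] := ipath_exists nsG v0.
have [n zn] := central_span.
have [b [g [bm bn gs] zb]] := zn (y0 (f n)) (ipath_deg yp0 _).
pose h a : kergrp f := insubd 0 (toZ (deg a) - toZ n).
have hE a : a \in msupp g -> kval (h a) = toZ (deg a) - toZ n.
  move=> ag; rewrite -[kval _]/(val (h a)) insubdK //.
  have e : gmor a = gmor b.
    apply: aperiodic_eq; first exact: gs ag.
    by move=> y yp ay; apply: (span_pcons gs zb ag yp); rewrite -(gs a).
  by rewrite inE fbarE -bn -!deg_gmor e subrr.
exists (\sum_(a <- msupp g) g@_a *: gbasis K (h a)) => //.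
have -> : iota (\sum_(a <- msupp g) g@_a *: gbasis K (h a)) =
    \sum_(a <- msupp g) g@_a *: U (h a).
  rewrite (big_morph iota (@iotaD K k l f G fin) (@iota0 K k l f G fin)).
  by apply: eq_bigr => a _; rewrite iotaZ iota_gbasis.
apply: (@rep_ext _ _ _ _ _ rfG nsG) => y t yp; apply/funext => -[x t'].
have o0 : src b = origin (pshift (f n) y0) by rewrite origin_pshift // -bm.
have sE : rep (\sum_(a <- msupp g) g@_a *: U (h a)) (delta K (y, t)) (x, t') =
    \sum_(a <- msupp g) g@_a * delta K (y, t + kval (h a)) (x, t').
  rewrite rep_sum linop_sumE; apply: eq_bigr => a _.
  by rewrite repZ linop_scaleE rep_Uelt_delta.
rewrite {}sE; have [xy|xy] := pselect (x = y); last first.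
  rewrite big1 => [|a _].
    apply/esym/eqP; apply: contrapT => /negP nz.
    exact/xy/(central_diag yp nz).
  by rewrite /delta asboolF ?mulr0 // => -[].
subst x; rewrite -[t'](subrK t) [t' - t + t]addrC -coefE (coef_const _ yp yp0).
rewrite -(pcons_pshift (f n) yp0) -bm.
rewrite (coef_span gs zb _ (ipath_pshift (f n) yp0) o0).
rewrite big_seq [RHS]big_seq; apply: eq_bigr => a ag.
rewrite hE // bn (@delta_eq _ _ _ _ (toZ (deg a) = toZ n + (t' - t))).
  by case: asboolP => [->|/eqP/negbTE ->]; rewrite ?eqxx ?mulr1 ?mulr0.
split=> [[/addrI ->]|->]; first by rewrite addrC subrK.
by rewrite [toZ n + _]addrC addrK.
Qed.

End Center.

Theorem corollary3p4 (K : fieldType) (k l : nat)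
    (f : {additive 'rV[nat]_k -> 'rV[nat]_l})
    (f_surj : forall m : 'rV[nat]_l, exists n : 'rV[nat]_k, f n = m)
    (Gamma : kgraph l) (Gamma_rf : row_finite Gamma)
    (Gamma_ns : no_sources Gamma)
    (Gamma_fin : finite_set [set: vtx Gamma])
    (Gamma_ne : [set: vtx Gamma] !=set0) :
  let U : kergrp f -> KPpb K f Gamma_fin := Uelt K Gamma_fin in
  let io : grpalg K (kergrp f) -> KPpb K f Gamma_fin :=
    kp_iota Gamma_fin in
  [/\ [/\ linear io, monoid_morphism io & forall h, io (gbasis K h) = U h],
      injective io,
      range io `<=` center (KPpb K f Gamma_fin),
      (forall g h, U h * U g = U (g + h)) /\
      (forall h, U h * U (- h) = 1 /\ U (- h) * U h = 1)
    & cofinal Gamma -> aperiodic Gamma ->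
      center (KPpb K f Gamma_fin) = range io].
Proof.
move=> U io; have [v0 _] := Gamma_ne.
have ioC : range io `<=` center (KPpb K f Gamma_fin).
  by move=> _ [x _ <-]; apply: iota_central.
split=> //.
- split; [exact: iota_linear|exact: iota_monoid_morphism|exact: iota_gbasis].
- exact: iota_inj v0.
- split=> [g h|h]; first by rewrite [RHS]/(U _) addrC; apply: UeltD.
  by split; rewrite /U UeltD // ?subrr ?addNr; apply: Uelt0.
move=> cofG apG; apply/seteqP; split=> // z zC.
exact: (center_iota f_surj Gamma_rf Gamma_ns cofG apG zC v0).
Qed.
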